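(* There is a constant $C$ such that for every string $x$, every integer $\alpha\ge0$ and every finite set $A\ni x$, there is a finite set $S\ni x$ such that, with $e=C\log\Lambda(A)$: $\Lambda(S)\le\lambda_x(\alpha)+(\delta(x\mid A)-\beta_x(\alpha))+e$, $K(S)\le K(A)+(\lambda_x(\alpha)-\Lambda(A))+(\delta(x\mid A)-\beta_x(\alpha))+e$, and $K(S)\le\alpha+(h_x(\alpha)-\log|A|)+(\delta(x\mid A)-\beta_x(\alpha))+e$.
   Context: Strings are finite binary strings; $K$ is prefix Kolmogorov complexity w.r.t. a fixed reference universal prefix machine. For a finite set $S$, $K(S)$ is the length of a shortest program that lists $S$ and halts; $K(x\mid S)$ is the complexity of $x$ given the list of $S$; $\Lambda(S)=K(S)+\log|S|$ (log base 2); for $x\in S$, $\delta(x\mid S)=\log|S|-K(x\mid S)$. For integer $\alpha\ge0$ (minima over finite $S$, $\min\emptyset=\infty$): $h_x(\alpha)=\min\{\log|S|: x\in S,K(S)\le\alpha\}$, $\lambda_x(\alpha)=\min\{\Lambda(S): x\in S,K(S)\le\alpha\}$, $\beta_x(\alpha)=\min\{\delta(x\mid S): x\in S,K(S)\le\alpha\}$. *)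

(* Defs.v *)
From mathcomp Require Import all_boot all_order all_algebra finmap.
From mathcomp Require Import boolp classical_sets reals ereal exp.

Set Implicit Arguments.
Unset Strict Implicit.
Unset Printing Implicit Defensive.

Import Order.TTheory GRing.Theory Num.Theory.

Local Open Scope classical_set_scope.
Local Open Scope ring_scope.

Definition str := seq bool.

(* Partial computable functions are given by a variable-free version of the
   WHILE language over binary trees (N. D. Jones, "Computability and Complexity
   from a Programming Perspective", 1997), which is Turing complete. *)
Inductive tree := Leaf | Node of tree & tree.

Definition left_of t := if t is Node l _ then l else Leaf.
Definition right_of t := if t is Node _ r then r else Leaf.

Inductive prog :=
  | PId
  | PNil
  | PFst
  | PSnd
  | PPair of prog & prog
  | PComp of prog & prog          (* [PComp c d] runs [d] first *)
  | PIf of prog & prog & prog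
  | PWhile of prog & prog.        (* [PWhile c d] repeats [d] until [c] gives [Leaf] *)

Inductive exec : prog -> tree -> tree -> Prop :=
  | ev_id t : exec PId t t
  | ev_nil t : exec PNil t Leaf
  | ev_fst t : exec PFst t (left_of t)
  | ev_snd t : exec PSnd t (right_of t)
  | ev_pair c d t u v : exec c t u -> exec d t v -> exec (PPair c d) t (Node u v)
  | ev_comp c d t u v : exec d t u -> exec c u v -> exec (PComp c d) t v
  | ev_if_false b c d t v : exec b t Leaf -> exec d t v -> exec (PIf b c d) t v
  | ev_if_true b c d t u u' v :
      exec b t (Node u u') -> exec c t v -> exec (PIf b c d) t v
  | ev_while_stop c d t : exec c t Leaf -> exec (PWhile c d) t t
  | ev_while_step c d t u u' t' v :
      exec c t (Node u u') -> exec d t t' -> exec (PWhile c d) t' v ->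
      exec (PWhile c d) t v.

Definition tree_of_bool (b : bool) := if b then Node Leaf Leaf else Leaf.

Definition tree_of_str (s : str) :=
  foldr (fun b t => Node (tree_of_bool b) t) Leaf s.

(* [runs M p y z]: on program [p], given the auxiliary string [y], the machine
   [M] halts with output [z]. A halting computation whose result does not
   represent a string counts as having no output. *)
Definition runs (M : prog) (p y z : str) : Prop :=
  exec M (Node (tree_of_str p) (tree_of_str y)) (tree_of_str z).

Definition prefix_machine (M : prog) : Prop :=
  forall y p q z z', runs M p y z -> runs M q y z' -> prefix p q -> p = q.

Definition universal_prefix_machine (U : prog) : Prop :=
  prefix_machine U /\
  forall M, prefix_machine M ->
    exists w, forall p y z, runs M p y z -> runs U (w ++ p) y z.

(* The complexity of [z] given [y]. The value 0 for an empty set of programs is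
   a default that is never taken when [U] is universal. *)
Definition Kcond (U : prog) (z y : str) : nat :=
  if pselect (exists n, `[< exists2 p, size p = n & runs U p y z >]) is left h
  then ex_minn h else 0%N.

(* The list of a finite set, in lexicographic order. *)
Definition listing (S : {fset str}) : seq str :=
  sort (fun s t => (s <= t :> seqlexi bool)%O) S.

(* Each bit [b] of an entry is written [1b], and each entry is ended by [0]. *)
Definition encode_str (s : str) : str :=
  flatten [seq [:: true; b] | b <- s] ++ [:: false].

Definition encode_list (l : seq str) : str := flatten (map encode_str l).

Definition Kset (U : prog) (S : {fset str}) : nat :=
  Kcond U (encode_list (listing S)) [::].

Definition Kgiven (U : prog) (x : str) (S : {fset str}) : nat :=
  Kcond U x (encode_list (listing S)).

Section StructureFunctions.
Context {R : realType}.

Definition log2 (r : R) : R := ln r / ln 2.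

Definition logcard (S : {fset str}) : R := log2 (#|` S|)%:R.

Definition Lambda (U : prog) (S : {fset str}) : R :=
  (Kset U S)%:R + logcard S.

Definition deficiency (U : prog) (x : str) (S : {fset str}) : R :=
  logcard S - (Kgiven U x S)%:R.

Definition models (U : prog) (x : str) (alpha : nat) : set {fset str} :=
  [set S | x \in S /\ (Kset U S <= alpha)%N].

(* Only finitely many sets [S] have [Kset U S <= alpha], so the infima below are
   minima, with value [+oo] when there is no such set containing [x]. *)
Definition h_fun (U : prog) (x : str) (alpha : nat) : \bar R :=
  ereal_inf [set (logcard S)%:E | S in models U x alpha].

Definition lambda_fun (U : prog) (x : str) (alpha : nat) : \bar R :=
  ereal_inf [set (Lambda U S)%:E | S in models U x alpha].

Definition beta_fun (U : prog) (x : str) (alpha : nat) : \bar R :=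
  ereal_inf [set (deficiency U x S)%:E | S in models U x alpha].

End StructureFunctions.

(* Main.v *)
Require Import Defs.
From mathcomp Require Import all_boot all_order all_algebra finmap.
From mathcomp Require Import boolp classical_sets reals ereal exp.
From HB Require Import structures.
From mathcomp Require Import zify lra.

Set Implicit Arguments.
Unset Strict Implicit.
Unset Printing Implicit Defensive.

Import Order.TTheory GRing.Theory Num.Theory.

(** Write [m = K(x)], [l = K(x|A)], [i = K(A)] and let [2^j] be the least power of
    two with [|A| <= 2^j]. Running a program for [B] and then one for [x] given [B]
    gives [K(x) <= K(B) + K(x|B)] up to a logarithm, so the three bounds are at
    least what they become when [lambda - beta] and [alpha + h - beta] are
    replaced by [m]. It suffices to find a set [S] that contains [x], with
    [|S| <= 2^j] and [K(S) <= m - l + O(log)].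

    Call [N] the number of sets of complexity [i] and size at most [2^j] that
    contain [x]. If [N < 2^k], with [k] close to [i + l - m], then [A] occurs in
    few pairs (string of complexity [m], set containing it), which makes [x]
    simple given [A], or else [A] is one of the few sets that occur in many pairs,
    which makes [A] simple; either is a contradiction. Hence [N >= 2^k].

    Enumerate all these sets, and after each batch of [2^(k-1)] of them cut the
    strings that have just reached multiplicity [2^(k-1)] into pieces of size
    [2^j]. The last batch may be incomplete, but [x] has reached this multiplicity
    before it. There are [O(2^(i-k))] pieces, so the piece [S] of [x] satisfies
    [K(S) <= i - k + O(log) = m - l + O(log)]. *)

(** * Computable functions on encoded data *)

(** Equality of trees is classical here: it serves to state membership in lists of trees and is
    never part of a computed function. *)
HB.instance Definition _ := gen_eqMixin tree.

Lemma exec_fun c t u v : exec c t u -> exec c t v -> u = v.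
Proof.
move=> h; elim: h v => {c t u}.
- by move=> t v h; inversion h.
- by move=> t v h; inversion h.
- by move=> t v h; inversion h.
- by move=> t v h; inversion h.
- move=> c d t u v _ IHc _ IHd w h; inversion h; subst.
  by rewrite (IHc _ H1) (IHd _ H4).
- move=> c d t u v _ IHd _ IHc w h; inversion h; subst.
  by move: (IHd _ H1) => e; subst; apply: IHc.
- move=> b c d t v _ IHb _ IHd w h; inversion h; subst; first exact: IHd.
  by have := IHb _ H4.
- move=> b c d t u u' v _ IHb _ IHc w h; inversion h; subst; last exact: IHc.
  by have := IHb _ H4.
- move=> c d t _ IHc w h; inversion h; subst => //.
  by have := IHc _ H1.
- move=> c d t u u' t' v _ IHc _ IHd _ IHw w h; inversion h; subst.
    by have := IHc _ H3.
  by move: (IHd _ H2) => e; subst; apply: IHw.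
Qed.

(** The codes are chosen so that strings are coded by [tree_of_str], numbers in unary, and booleans
    as the test of [PIf] expects. *)
Class encodable (T : Type) := code : T -> tree.

#[global] Instance enc_tree : encodable tree := id.
#[global] Instance enc_bool : encodable bool := tree_of_bool.
Fixpoint code_nat n := if n is n'.+1 then Node Leaf (code_nat n') else Leaf.
#[global] Instance enc_nat : encodable nat := code_nat.
#[global] Instance enc_prod X Y `{encodable X} `{encodable Y} :
  encodable (X * Y) := fun p => Node (code p.1) (code p.2).
#[global] Instance enc_seq X `{encodable X} : encodable (seq X) :=
  foldr (fun x t => Node (code x) t) Leaf.

(** Only total functions are covered; unbounded search enters with [listing_machine]. In the closure
    lemmas, [G] collects the free variables of an expression, so that they apply under binders. *)
Definition computable X Y `{encodable X} `{encodable Y} (f : X -> Y) : Prop :=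
  exists c, forall x, exec c (code x) (code (f x)).

(** * Closure under the constructs of the language, folds and iteration *)

Section Closure.
Context {G : Type} `{encodable G}.

Lemma cmp_id : computable (fun g : G => g).
Proof. by exists PId => x; constructor. Qed.

Lemma cmp_comp Y Z `{encodable Y} `{encodable Z} (f : Y -> Z) (a : G -> Y) :
  computable f -> computable a -> computable (fun g => f (a g)).
Proof.
by move=> [c hc] [d hd]; exists (PComp c d) => x; exact: ev_comp (hd x) (hc _).
Qed.

Lemma cmp_const Y `{encodable Y} (y : Y) : computable (fun _ : G => y).
Proof.
rewrite /computable; elim: (code y) => [|t [c hc] u [d hd]].
  by exists PNil => x; constructor.
by exists (PPair c d) => x; constructor.
Qed.

Section Pairs.
Context {Y Z : Type} `{encodable Y} `{encodable Z}.

Lemma cmp_pair (a : G -> Y) (b : G -> Z) :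
  computable a -> computable b -> computable (fun g => (a g, b g)).
Proof.
by move=> [c hc] [d hd]; exists (PPair c d) => x; exact: ev_pair (hc x) (hd x).
Qed.

Lemma cmp_fst (a : G -> Y * Z) : computable a -> computable (fun g => (a g).1).
Proof.
move=> [c hc]; exists (PComp PFst c) => x; apply: ev_comp (hc x) _.
exact: ev_fst.
Qed.

Lemma cmp_snd (a : G -> Y * Z) : computable a -> computable (fun g => (a g).2).
Proof.
move=> [c hc]; exists (PComp PSnd c) => x; apply: ev_comp (hc x) _.
exact: ev_snd.
Qed.

Lemma cmp_if (b : G -> bool) (f h : G -> Y) :
  computable b -> computable f -> computable h ->
  computable (fun g => if b g then f g else h g).
Proof.
move=> [c hc] [d hd] [e he]; exists (PIf c d e) => x.
have := hc x; case: (b x) => hb.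
  exact: ev_if_true hb (hd x).
exact: ev_if_false hb (he x).
Qed.

(* The loop state is [((g, accumulator), remaining list)]. *)
Lemma cmp_foldl (f : G -> Y -> Z -> Y) (a : G -> Y) (l : G -> seq Z) :
  computable (fun p : G * Y * Z => f p.1.1 p.1.2 p.2) ->
  computable a -> computable l ->
  computable (fun g => foldl (f g) (a g) (l g)).
Proof.
move=> [cf hf] [ca ha] [cl hl].
pose st := PPair (PPair (PComp PFst PFst)
  (PComp cf (PPair PFst (PComp PFst PSnd)))) (PComp PSnd PSnd).
exists (PComp (PComp PSnd PFst)
   (PComp (PWhile PSnd st) (PPair (PPair PId ca) cl))) => x.
apply: (@ev_comp _ _ _ (code ((x, foldl (f x) (a x) (l x)), [::] : seq Z))); last first.
  by apply: ev_comp; [exact: ev_fst | exact: ev_snd].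
apply: (@ev_comp _ _ _ (code ((x, a x), l x))).
  apply: ev_pair; last exact: hl.
  by apply: ev_pair; [exact: ev_id | exact: ha].
elim: (l x) (a x) => [|z s IH] y; first by apply: ev_while_stop; exact: ev_snd.
apply: (@ev_while_step _ _ _ (code z) (code s) (code ((x, f x y z), s))).
- exact: ev_snd.
- apply: ev_pair; last by apply: ev_comp; exact: ev_snd.
  apply: ev_pair; first by apply: ev_comp; exact: ev_fst.
  apply: ev_comp; last exact: (hf ((x, y), z)).
  apply: ev_pair; first exact: ev_fst.
  by apply: ev_comp; [exact: ev_snd | exact: ev_fst].
- exact: IH.
Qed.

End Pairs.

Section Seqs.
Context {Y : Type} `{encodable Y}.

Lemma cmp_cons (a : G -> Y) (l : G -> seq Y) :
  computable a -> computable l -> computable (fun g => a g :: l g).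
Proof.
by move=> [c hc] [d hd]; exists (PPair c d) => x; exact: ev_pair (hc x) (hd x).
Qed.

Lemma cmp_behead (l : G -> seq Y) :
  computable l -> computable (fun g => behead (l g)).
Proof.
move=> [c hc]; exists (PComp PSnd c) => x; apply: ev_comp (hc x) _.
have -> : code (behead (l x)) = right_of (code (l x)) by case: (l x).
exact: ev_snd.
Qed.

Lemma cmp_nilp (l : G -> seq Y) :
  computable l -> computable (fun g => nilp (l g)).
Proof.
move=> [c hc]; exists (PIf c PNil (PPair PNil PNil)) => x.
have := hc x; case: (l x) => [|y s] h.
  by apply: ev_if_false h _; apply: ev_pair; exact: ev_nil.
by apply: ev_if_true h _; exact: ev_nil.
Qed.

Lemma cmp_head (y0 : Y) (l : G -> seq Y) :
  computable l -> computable (fun g => head y0 (l g)).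
Proof.
move=> [c hc]; have [d hd] := cmp_const y0.
exists (PIf c (PComp PFst c) d) => x.
have := hc x; case: (l x) => [|y s] h; first exact: ev_if_false h (hd x).
by apply: ev_if_true (h) _; apply: ev_comp h _; exact: ev_fst.
Qed.

End Seqs.

(** Here [f] is the identity on codes, so the program for [a] also computes [f (a g)]. *)
Lemma cmp_tree_list (a : G -> tree) (f : tree -> seq tree) :
  (forall t, code (f t) = t) -> computable a -> computable (fun g => f (a g)).
Proof. by move=> hf [c hc]; exists c => x; rewrite hf. Qed.

Lemma cmp_list_tree (a : G -> str) :
  computable a -> computable (fun g => tree_of_str (a g)).
Proof. by []. Qed.

Lemma cmp_node (a b : G -> tree) :
  computable a -> computable b -> computable (fun g => Node (a g) (b g)).
Proof. exact: (@cmp_pair tree tree). Qed.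

Lemma cmp_left (a : G -> tree) :
  computable a -> computable (fun g => left_of (a g)).
Proof.
move=> [c hc]; exists (PComp PFst c) => x; apply: ev_comp (hc x) _.
exact: ev_fst.
Qed.

Lemma cmp_right (a : G -> tree) :
  computable a -> computable (fun g => right_of (a g)).
Proof.
move=> [c hc]; exists (PComp PSnd c) => x; apply: ev_comp (hc x) _.
exact: ev_snd.
Qed.

Lemma cmp_succ (a : G -> nat) : computable a -> computable (fun g => (a g).+1).
Proof.
move=> [c hc]; exists (PPair PNil c) => x; apply: ev_pair (hc x).
exact: ev_nil.
Qed.

Lemma cmp_pred (a : G -> nat) : computable a -> computable (fun g => (a g).-1).
Proof.
move=> [c hc]; exists (PComp PSnd c) => x; apply: ev_comp (hc x) _.
have -> : code (a x).-1 = right_of (code (a x)) by case: (a x).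
exact: ev_snd.
Qed.

(** The unary code of a number is also the code of a list of that many leaves, so iteration becomes
    a fold. *)
Lemma cmp_iter Y `{encodable Y} (n : G -> nat) (f : G -> Y -> Y) (a : G -> Y) :
  computable (fun p : G * Y => f p.1 p.2) -> computable a -> computable n ->
  computable (fun g => iter (n g) (f g) (a g)).
Proof.
move=> cf ca [d hd].
have hn : computable (fun g => nseq (n g) Leaf).
  exists d => x; have -> // : code (nseq (n x) Leaf) = code (n x).
  by elim: (n x) => //= k; rewrite /code /= => ->.
have h : computable (fun g => foldl (fun y (_ : tree) => f g y) (a g) (nseq (n g) Leaf)).
  apply: (cmp_foldl (f := fun g y _ => f g y)) => //.
  case: cf => c hc; exists (PComp c PFst) => x.
  by apply: ev_comp; [exact: ev_fst | exact: hc].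
case: h => c hc; exists c => x; have := hc x.
suff -> : foldl (fun y (_ : tree) => f x y) (a x) (nseq (n x) Leaf) =
    iter (n x) (f x) (a x) by [].
by elim: (n x) (a x) => //= k IH y; rewrite IH -iterSr.
Qed.

End Closure.

Lemma eq_computable X Y `{encodable X} `{encodable Y} (f h : X -> Y) :
  f =1 h -> computable f -> computable h.
Proof. by move=> e [c hc]; exists c => x; rewrite -e. Qed.

Notation computable2 f := (computable (fun p => f p.1 p.2)).

Lemma cmp_comp2 G X Y Z `{encodable G} `{encodable X} `{encodable Y}
    `{encodable Z} (f : X -> Y -> Z) (a : G -> X) (b : G -> Y) :
  computable2 f -> computable a -> computable b ->
  computable (fun g => f (a g) (b g)).
Proof.
move=> hf ha hb.
exact: (cmp_comp (f := fun p => f p.1 p.2) (a := fun g => (a g, b g)) hf (cmp_pair ha hb)).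
Qed.

(** Computability goals are solved by reading the head symbol of the function body and applying the
    matching closure lemma. [cmp_ext] is a hook, extended as further functions become available. *)
Ltac cmp_ext := fail.
Ltac cmp_step :=
  first
  [ match goal with
    | H : computable ?a |- computable ?a => exact H
    | H : computable ?a |- computable (fun p => ?a (@?q p)) =>
        apply (cmp_comp (a := q) H)
    | H : computable (fun p => ?f p.1 p.2) |-
        computable (fun g => ?f (@?a g) (@?b g)) =>
        apply (cmp_comp2 (a := a) (b := b) H)
    end
  | lazymatch goal with
    | |- computable fst => exact (cmp_fst cmp_id)
    | |- computable snd => exact (cmp_snd cmp_id)
    | |- computable S => exact (cmp_succ cmp_id)
    | |- computable predn => exact (cmp_pred cmp_id)
    | |- computable (fun _ => ?y) => exact (cmp_const y)
    | |- computable (fun g => g) => exact cmp_id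
    | |- computable (fun g => fst (@?a g)) => apply cmp_fst
    | |- computable (fun g => snd (@?a g)) => apply cmp_snd
    | |- computable (fun g => pair (@?a g) (@?b g)) => apply cmp_pair
    | |- computable (fun g => cons (@?a g) (@?b g)) => apply cmp_cons
    | |- computable (fun g => if _ then _ else _) => apply cmp_if
    | |- computable (fun g => foldl (@?a g) (@?b g) (@?c g)) =>
        apply (cmp_foldl (f := a))
    | |- computable (fun g => iter (@?a g) (@?b g) (@?c g)) =>
        apply (cmp_iter (f := b))
    | |- computable (fun g => nilp (@?a g)) => apply cmp_nilp
    | |- computable (fun g => behead (@?a g)) => apply cmp_behead
    | |- computable (fun g => head ?x (@?a g)) => apply cmp_head
    | |- computable (fun g => S (@?a g)) => apply cmp_succ
    | |- computable (fun g => predn (@?a g)) => apply cmp_pred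
    | |- computable (fun g => Node (@?a g) (@?b g)) => apply cmp_node
    | |- computable (fun g => left_of (@?a g)) => apply cmp_left
    | |- computable (fun g => right_of (@?a g)) => apply cmp_right
    | |- computable (fun g => tree_of_str (@?a g)) => apply cmp_list_tree
    end
  | cmp_ext ].
Ltac cmp := repeat (cmp_step; cbv beta).

(** * Booleans, lists and arithmetic *)

Section Derived.
Context {G : Type} `{encodable G}.

Lemma cmp_negb (a : G -> bool) : computable a -> computable (fun g => ~~ a g).
Proof. by move=> ha; apply: (@eq_computable _ _ _ _ (fun g => if a g then false else true)); cmp. Qed.

Lemma cmp_andb (a b : G -> bool) :
  computable a -> computable b -> computable (fun g => a g && b g).
Proof. by move=> ha hb; rewrite /andb; cmp. Qed.

Lemma cmp_orb (a b : G -> bool) :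
  computable a -> computable b -> computable (fun g => a g || b g).
Proof. by move=> ha hb; rewrite /orb; cmp. Qed.

Lemma cmp_eqb (a b : G -> bool) :
  computable a -> computable b -> computable (fun g => a g == b g).
Proof.
move=> ha hb; have hc := cmp_negb hb.
apply: (@eq_computable _ _ _ _ (fun g => if a g then b g else ~~ b g)); last by cmp.
by move=> g; case: (a g); case: (b g).
Qed.

Section Lists.
Context {X : Type} `{encodable X}.

Lemma cmp_catrev (a b : G -> seq X) :
  computable a -> computable b -> computable (fun g => catrev (a g) (b g)).
Proof.
move=> ha hb.
apply: (@eq_computable _ _ _ _ (fun g => foldl (fun s x => x :: s) (b g) (a g))).
  by move=> g; elim: (a g) (b g) => //= x s IH t; rewrite IH.
by cmp.
Qed.

Lemma cmp_rev (a : G -> seq X) : computable a -> computable (fun g => rev (a g)).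
Proof. by move=> ha; rewrite /rev; apply: cmp_catrev; cmp. Qed.

Lemma cmp_cat (a b : G -> seq X) :
  computable a -> computable b -> computable (fun g => a g ++ b g).
Proof.
move=> ha hb; have hr := cmp_rev ha.
apply: (@eq_computable _ _ _ _ (fun g => catrev (rev (a g)) (b g))).
  by move=> g; rewrite catrevE revK.
by apply: cmp_catrev.
Qed.

Lemma cmp_rcons (l : G -> seq X) (a : G -> X) :
  computable l -> computable a -> computable (fun g => rcons (l g) (a g)).
Proof.
move=> hl ha.
apply: (@eq_computable _ _ _ _ (fun g => l g ++ [:: a g])).
  by move=> g; rewrite cats1.
by apply: cmp_cat; cmp.
Qed.

End Lists.

Section Lists2.
Context {X Y : Type} `{encodable X} `{encodable Y}.

Lemma cmp_map (f : G -> X -> Y) (l : G -> seq X) :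
  computable2 f -> computable l -> computable (fun g => map (f g) (l g)).
Proof.
move=> hf hl.
apply: (@eq_computable _ _ _ _
  (fun g => rev (foldl (fun s x => f g x :: s) [::] (l g)))); last first.
  by apply: cmp_rev; cmp.
move=> g; suff -> s : foldl (fun s x => f g x :: s) s (l g) =
  catrev (map (f g) (l g)) s by rewrite revK.
by elim: (l g) s => //= x t IH s; rewrite IH.
Qed.

Lemma cmp_filter (f : G -> X -> bool) (l : G -> seq X) :
  computable2 f -> computable l -> computable (fun g => seq.filter (f g) (l g)).
Proof.
move=> hf hl.
apply: (@eq_computable _ _ _ _
  (fun g => rev (foldl (fun s x => if f g x then x :: s else s) [::] (l g)))); last first.
  by apply: cmp_rev; cmp.
move=> g; suff -> s : foldl (fun s x => if f g x then x :: s else s) s (l g) =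
  catrev (seq.filter (f g) (l g)) s by rewrite revK.
by elim: (l g) s => //= x t IH s; rewrite IH; case: (f g x).
Qed.

Lemma cmp_has (f : G -> X -> bool) (l : G -> seq X) :
  computable2 f -> computable l -> computable (fun g => has (f g) (l g)).
Proof.
move=> hf hl.
apply: (@eq_computable _ _ _ _
  (fun g => foldl (fun s x => if s then true else f g x) false (l g))); last by cmp.
move=> g; suff -> s : foldl (fun s x => if s then true else f g x) s (l g) =
  s || has (f g) (l g) by [].
by elim: (l g) s => [|x t IH] [] //=; rewrite ?IH.
Qed.

Lemma cmp_size (l : G -> seq X) : computable l -> computable (fun g => size (l g)).
Proof.
move=> hl.
apply: (@eq_computable _ _ _ _ (fun g => foldl (fun n _ => n.+1) 0 (l g))); last by cmp.
move=> g; suff -> n : foldl (fun n _ => n.+1) n (l g) = n + size (l g) by [].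
by elim: (l g) n => [|x t IH] n /=; rewrite ?addn0 // IH addSnnS.
Qed.

Lemma cmp_drop (n : G -> nat) (l : G -> seq X) :
  computable n -> computable l -> computable (fun g => drop (n g) (l g)).
Proof.
move=> hn hl; apply: (@eq_computable _ _ _ _ (fun g => iter (n g) behead (l g))).
  by move=> g; rewrite drop_behead.
by cmp.
Qed.

Lemma cmp_nth (x0 : X) (l : G -> seq X) (n : G -> nat) :
  computable l -> computable n -> computable (fun g => nth x0 (l g) (n g)).
Proof.
move=> hl hn; have hd := cmp_drop hn hl.
apply: (@eq_computable _ _ _ _ (fun g => head x0 (drop (n g) (l g)))); last by cmp.
by move=> g; rewrite -nth0 nth_drop addn0.
Qed.

Lemma cmp_take (x0 : X) (n : G -> nat) (l : G -> seq X) :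
  computable n -> computable l -> computable (fun g => take (n g) (l g)).
Proof.
move=> hn hl.
(* The state holds the part taken so far, reversed, and the rest of the list. *)
pose st (p : seq X * seq X) :=
  if nilp p.2 then p else (head x0 p.2 :: p.1, behead p.2).
apply: (@eq_computable _ _ _ _ (fun g => rev (iter (n g) st ([::], l g)).1)); last first.
  by apply: cmp_rev; cmp; rewrite /st; cmp.
move=> g; suff -> s : (iter (n g) st (s, l g)).1 = catrev (take (n g) (l g)) s by rewrite revK.
elim: (n g) (l g) s => [|m IH] [|x t] s //=.
  by rewrite -iterS iterSr /st /= IH.
by rewrite -iterS iterSr /st /= IH.
Qed.

End Lists2.

End Derived.

Section Flatten.
Context {G : Type} `{encodable G}.

Lemma cmp_flatten X `{encodable X} (l : G -> seq (seq X)) :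
  computable l -> computable (fun g => flatten (l g)).
Proof.
move=> hl.
apply: (@eq_computable _ _ _ _ (fun g => foldl (fun s x => s ++ x) [::] (l g))).
  move=> g; suff -> s : foldl (fun s x => s ++ x) s (l g) = s ++ flatten (l g) by [].
  by elim: (l g) s => [|x t IH] s /=; rewrite ?cats0 // IH catA.
by cmp; apply: cmp_cat; cmp.
Qed.

Lemma cmp_addn (a b : G -> nat) :
  computable a -> computable b -> computable (fun g => a g + b g).
Proof.
move=> ha hb; apply: (@eq_computable _ _ _ _ (fun g => iter (a g) S (b g))); last by cmp.
by move=> g; rewrite iter_succn addnC.
Qed.

Lemma cmp_subn (a b : G -> nat) :
  computable a -> computable b -> computable (fun g => a g - b g).
Proof.
move=> ha hb; apply: (@eq_computable _ _ _ _ (fun g => iter (b g) predn (a g))); last by cmp.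
by move=> g; rewrite iter_predn.
Qed.

Lemma cmp_leq (a b : G -> nat) :
  computable a -> computable b -> computable (fun g => a g <= b g).
Proof.
move=> ha hb; have hs := cmp_subn ha hb.
apply: (@eq_computable _ _ _ _ (fun g => iter (a g - b g) (fun=> false) true)); last by cmp.
by move=> g; rewrite /leq; case: (a g - b g).
Qed.

Lemma cmp_eqn (a b : G -> nat) :
  computable a -> computable b -> computable (fun g => a g == b g).
Proof.
move=> ha hb; apply: (@eq_computable _ _ _ _ (fun g => (a g <= b g) && (b g <= a g))).
  by move=> g; rewrite eqn_leq.
by apply: cmp_andb; apply: cmp_leq.
Qed.

End Flatten.

Section Power.
Context {G : Type} `{encodable G}.

Lemma cmp_expn2 (a : G -> nat) : computable a -> computable (fun g => 2 ^ a g).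
Proof.
move=> ha; apply: (@eq_computable _ _ _ _ (fun g => iter (a g) (fun n => n + n) 1)).
  by move=> g; elim: (a g) => //= n ->; rewrite expnS mul2n addnn.
by cmp; apply: cmp_addn; cmp.
Qed.

End Power.

Ltac cmp_ext1 :=
  lazymatch goal with
  | |- computable (fun g => negb (@?a g)) => apply cmp_negb
  | |- computable (fun g => andb (@?a g) (@?b g)) => apply cmp_andb
  | |- computable (fun g => orb (@?a g) (@?b g)) => apply cmp_orb
  | |- computable (fun g => catrev (@?a g) (@?b g)) => apply cmp_catrev
  | |- computable (fun g => rev (@?a g)) => apply cmp_rev
  | |- computable (fun g => cat (@?a g) (@?b g)) => apply cmp_cat
  | |- computable (fun g => rcons (@?a g) (@?b g)) => apply cmp_rcons
  | |- computable (fun g => flatten (@?a g)) => apply cmp_flatten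
  | |- computable (fun g => map (@?f g) (@?a g)) => apply (cmp_map (f := f))
  | |- computable (fun g => seq.filter (@?f g) (@?a g)) =>
      apply (cmp_filter (f := f))
  | |- computable (fun g => has (@?f g) (@?a g)) => apply (cmp_has (f := f))
  | |- computable (fun g => size (@?a g)) => apply cmp_size
  | |- computable (fun g => drop (@?a g) (@?b g)) => apply cmp_drop
  | |- computable (fun g => nth ?x (@?a g) (@?b g)) => apply cmp_nth
  | |- computable (fun g => @take str (@?a g) (@?b g)) => apply (cmp_take [::])
  | |- computable (fun g => addn (@?a g) (@?b g)) => apply cmp_addn
  | |- computable (fun g => subn (@?a g) (@?b g)) => apply cmp_subn
  | |- computable (fun g => leq (@?a g) (@?b g)) => apply cmp_leq
  | |- computable (fun g => expn 2 (@?a g)) => apply cmp_expn2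
  | |- computable (fun g => @eq_op _ (@?a g) (@?b g)) =>
      first [apply cmp_eqn | apply cmp_eqb]
  end.
Ltac cmp_ext ::= cmp_ext1.

Section Derived2.
Context {G : Type} `{encodable G}.

Lemma cmp_muln (a b : G -> nat) :
  computable a -> computable b -> computable (fun g => a g * b g).
Proof.
move=> ha hb; apply: (@eq_computable _ _ _ _ (fun g => iter (a g) (addn (b g)) 0)); last by cmp.
by move=> g; rewrite iter_addn_0 mulnC.
Qed.

Lemma cmp_count X `{encodable X} (f : G -> X -> bool) (l : G -> seq X) :
  computable2 f -> computable l -> computable (fun g => count (f g) (l g)).
Proof.
move=> hf hl; apply: (@eq_computable _ _ _ _ (fun g => size (seq.filter (f g) (l g)))).
  by move=> g; rewrite size_filter.
by cmp.
Qed.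

Lemma cmp_iota1 (n : G -> nat) : computable n -> computable (fun g => iota 1 (n g)).
Proof.
move=> hn.
apply: (@eq_computable _ _ _ _
  (fun g => iter (n g) (fun s => rcons s (size s).+1) [::])); last by cmp.
move=> g; elim: (n g) => // k IH.
by rewrite iterS IH size_iota -cats1 -(addn1 k) iotaD add1n addn1.
Qed.

End Derived2.

Section Derived3.
Context {G : Type} `{encodable G}.

Lemma cmp_iota0 (n : G -> nat) : computable n -> computable (fun g => iota 0 (n g)).
Proof.
move=> hn.
apply: (@eq_computable _ _ _ _ (fun g => map predn (iota 1 (n g)))); last first.
  by have := cmp_iota1 hn; move=> h; cmp.
by move=> g; rewrite (iotaDl 1 0) -map_comp map_id_in.
Qed.

Lemma cmp_sumn (l : G -> seq nat) : computable l -> computable (fun g => sumn (l g)).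
Proof.
move=> hl; apply: (@eq_computable _ _ _ _ (fun g => foldl addn 0 (l g))); last by cmp.
by move=> g; rewrite sumnE foldl_foldr ?foldrE //; [exact: addnA | exact: addnC].
Qed.

Lemma cmp_eqstr (a b : G -> str) :
  computable a -> computable b -> computable (fun g => a g == b g).
Proof.
move=> ha hb.
(* The state tells whether all bits have matched so far and holds the rest of [b g]. *)
pose st (p : bool * str) (c : bool) :=
  ([&& p.1, ~~ nilp p.2 & head false p.2 == c], behead p.2).
apply: (@eq_computable _ _ _ _
  (fun g => let r := foldl st (true, b g) (a g) in r.1 && nilp r.2)); last first.
  have h : computable (fun g => foldl st (true, b g) (a g)) by cmp; rewrite /st; cmp.
  by rewrite /=; cmp.
move=> g /=; have e : forall s t, (foldl st (false, t) s).1 = false.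
  by elim=> //= x s IH t; rewrite /st /= IH.
elim: (a g) (b g) => [|x s IH] [|y t] //=; rewrite {2 4}/st /= ?e //.
by rewrite eqseq_cons [x == y]eq_sym; case: (y == x); rewrite /= ?e // IH.
Qed.

End Derived3.

Section Derived4.
Context {G : Type} `{encodable G}.

Lemma cmp_mem (a : G -> str) (l : G -> seq str) :
  computable a -> computable l -> computable (fun g => a g \in l g).
Proof.
move=> ha hl; apply: (@eq_computable _ _ _ _ (fun g => has (fun y => a g == y) (l g))).
  by move=> g; rewrite -has_pred1; apply: eq_has => y /=; rewrite eq_sym.
by cmp; apply: cmp_eqstr; cmp.
Qed.

End Derived4.

Section Derived5.
Context {G : Type} `{encodable G}.

Lemma cmp_index (a : G -> str) (l : G -> seq str) :
  computable a -> computable l -> computable (fun g => index (a g) (l g)).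
Proof.
move=> ha hl.
pose st (x : str) (p : bool * nat) y :=
  if p.1 then p else if y == x then (true, p.2) else (false, p.2.+1).
apply: (@eq_computable _ _ _ _ (fun g => (foldl (st (a g)) (false, 0) (l g)).2)); last first.
  by cmp; rewrite /st; cmp; apply: cmp_eqstr; cmp.
move=> g; rewrite -[RHS]add0n; elim: (l g) 0 => [|y s IH] n /=; first by rewrite addn0.
rewrite {2}/st /=; case: eqP => _; last by rewrite IH addSnnS.
by rewrite addn0; elim: s {IH} => // z s IH; rewrite /= {2}/st.
Qed.

End Derived5.

Ltac cmp_ext2 :=
  lazymatch goal with
  | |- computable (fun g => muln (@?a g) (@?b g)) => apply cmp_muln
  | |- computable (fun g => count (@?f g) (@?a g)) => apply (cmp_count (f := f))
  | |- computable (fun g => iota 0 (@?a g)) => apply cmp_iota0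
  | |- computable (fun g => iota 1 (@?a g)) => apply cmp_iota1
  | |- computable (fun g => sumn (@?a g)) => apply cmp_sumn
  | |- computable (fun g => @eq_op _ (@?a g) (@?b g)) => apply cmp_eqstr
  | |- computable (fun g => in_mem (@?a g) (mem (@?b g))) => apply cmp_mem
  | |- computable (fun g => index (@?a g) (@?b g)) => apply cmp_index
  end.
Ltac cmp_ext ::= first [cmp_ext1 | cmp_ext2].

(** * Evaluation with bounded loops, enumerations *)

Definition is_leaf (t : tree) := if t is Leaf then true else false.

Fixpoint spine (t : tree) : seq tree :=
  if t is Node a b then a :: spine b else [::].

Lemma code_spine t : code (spine t) = t.
Proof. by elim: t => //= a _ b IH; rewrite -[in RHS]IH. Qed.

Lemma cmp_spine G `{encodable G} (a : G -> tree) :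
  computable a -> computable (fun g => spine (a g)).
Proof. by apply: cmp_tree_list; exact: code_spine. Qed.

Lemma cmp_is_leaf G `{encodable G} (a : G -> tree) :
  computable a -> computable (fun g => is_leaf (a g)).
Proof.
move=> ha; have hs := cmp_spine ha.
apply: (@eq_computable _ _ _ _ (fun g => nilp (spine (a g)))); last by cmp.
by move=> g; case: (a g).
Qed.

Definition str_of_tree (t : tree) : str := [seq ~~ is_leaf a | a <- spine t].

Lemma tree_of_strK s : str_of_tree (tree_of_str s) = s.
Proof.
by rewrite /str_of_tree; elim: s => //= b s IH; rewrite -[in RHS]IH; case: b.
Qed.

Lemma cmp_str_of_tree G `{encodable G} (a : G -> tree) :
  computable a -> computable (fun g => str_of_tree (a g)).
Proof.
move=> ha; have hs := cmp_spine ha; rewrite /str_of_tree; cmp.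
by apply: cmp_is_leaf; cmp.
Qed.

(* [run c n t] lists the results (at most one) that [c] yields on [t] when each
   loop may make [n] rounds. In a loop, the flag of a state tells whether the
   loop has stopped. *)
Definition loop_step (c d : tree -> seq tree) (s : seq (bool * tree)) :=
  flatten [seq if x.1 then [:: x] else
    flatten [seq if is_leaf u then [:: (true, x.2)]
                 else [seq (false, t) | t <- d x.2] | u <- c x.2] | x <- s].

Fixpoint run (c : prog) (n : nat) (t : tree) : seq tree :=
  match c with
  | PId => [:: t]
  | PNil => [:: Leaf]
  | PFst => [:: left_of t]
  | PSnd => [:: right_of t]
  | PPair c d => flatten [seq [seq Node u v | v <- run d n t] | u <- run c n t]
  | PComp c d => flatten [seq run c n u | u <- run d n t]
  | PIf b c d =>
      flatten [seq if is_leaf u then run d n t else run c n t | u <- run b n t]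
  | PWhile c d =>
      [seq x.2 | x <- [seq x <- iter n (loop_step (run c n) (run d n)) [:: (false, t)] | x.1]]
  end.

(** By induction on [c], which stays outside the coded data: bounded evaluation of each construct is
    an expression in list operations. *)
Lemma cmp_run_nt c :
  computable (fun p : nat * tree => run c p.1 p.2).
Proof.
elim: c => [||||c hc d hd|c hc d hd|b hb c hc d hd|c hc d hd] /=.
- by cmp.
- by cmp.
- by cmp.
- by cmp.
- by cmp.
- by cmp.
- by cmp; apply: cmp_is_leaf; cmp.
- by cmp; rewrite /loop_step; cmp; apply: cmp_is_leaf; cmp.
Qed.

Lemma cmp_run c G `{encodable G} (n : G -> nat) (t : G -> tree) :
  computable n -> computable t -> computable (fun g => run c (n g) (t g)).
Proof. by move=> hn ht; have h := cmp_run_nt c; cmp. Qed.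

Lemma mem_loop_step c d s x :
  x \in loop_step c d s ->
  exists2 y, y \in s &
    if y.1 then x = y else exists2 u, u \in c y.2 &
      if is_leaf u then x = (true, y.2) else exists2 t, t \in d y.2 & x = (false, t).
Proof.
move=> /flatten_mapP[y ys hx]; exists y => //; move: hx.
case: y.1; first by rewrite inE => /eqP.
move=> /flatten_mapP[u uc hx]; exists u => //; move: hx.
case: is_leaf; first by rewrite inE => /eqP.
by move=> /mapP[t td ->]; exists t.
Qed.

Lemma run_sound c n t v : v \in run c n t -> exec c t v.
Proof.
elim: c t v => [||||c hc d hd|c hc d hd|b hb c hc d hd|c hc d hd] t v /=.
- by rewrite inE => /eqP ->; constructor.
- by rewrite inE => /eqP ->; constructor.
- by rewrite inE => /eqP ->; constructor.
- by rewrite inE => /eqP ->; constructor.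
- move=> /flatten_mapP[u /hc hu] /mapP[w /hd hw ->].
  exact: ev_pair.
- move=> /flatten_mapP[u /hd hu] /hc hw.
  exact: ev_comp hu hw.
- move=> /flatten_mapP[[|u u'] /hb hu] /=.
    by move=> /hd; exact: ev_if_false.
  by move=> /hc; exact: ev_if_true hu.
- move=> /mapP[[b w]]; rewrite mem_filter /= => /andP[hb] + ->.
  have {hb} -> : b = true by [].
  set f := loop_step _ _.
  (* A stopped state found after [k] rounds was already in [s], or comes from a running state of [s]
     on which the loop really yields its result. *)
  suff h k s x : x \in iter k f s -> x.1 ->
      exists2 y, y \in s & if y.1 then x = y else exec (PWhile c d) y.2 x.2.
    by move=> /h /(_ isT) [y]; rewrite inE => /eqP ->.
  elim: k s => [|k IH] s.
    by move=> /= xs hx; exists x => //; rewrite hx.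
  rewrite iterSr => /IH h /h [y] /mem_loop_step [z zs].
  case hz: z.1.
    by move=> -> hx; exists z => //; rewrite hz; move: hx; rewrite hz.
  move=> [[|u u'] /hc hu] /=.
    move=> -> /= ->; exists z => //; rewrite hz /=.
    exact: ev_while_stop.
  move=> [t' /hd ht ->] /= hx; exists z => //; rewrite hz.
  exact: ev_while_step hu ht hx.
Qed.

Lemma iter_loop_done c d k (x : bool * tree) s :
  x.1 -> x \in s -> x \in iter k (loop_step c d) s.
Proof.
move=> hx; elim: k s => //= k IH s xs.
by apply/flatten_mapP; exists x; [exact: IH | rewrite hx inE].
Qed.

Lemma run_complete c t v :
  exec c t v -> exists N, forall n, N <= n -> v \in run c n t.
Proof.
pose P c t v := exists N, forall n, N <= n -> v \in run c n t.
(* In the induction for a loop the number of rounds drops while the bound on inner evaluations stays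
   fixed, so [Q] lets the two vary independently. *)
pose Q c t v := if c is PWhile c d then exists N, forall n k, N <= n -> N <= k ->
   (true, v) \in iter k (loop_step (run c n) (run d n)) [:: (false, t)] else P c t v.
suff : exec c t v -> Q c t v.
  move=> h /h {h}; case: c => //= c d [N h]; exists N => n Nn /=.
  by apply/mapP; exists (true, v) => //; rewrite mem_filter /= h.
have QP : forall c t v, Q c t v -> P c t v.
  move=> {}c {}t {}v; case: c => //= c d [N h]; exists N => n Nn /=.
  by apply/mapP; exists (true, v) => //; rewrite mem_filter /= h.
elim=> {c t v}.
- by move=> t; exists 0 => n _; rewrite inE.
- by move=> t; exists 0 => n _; rewrite inE.
- by move=> t; exists 0 => n _; rewrite inE.
- by move=> t; exists 0 => n _; rewrite inE.
- move=> c d t u v _ /QP[N hN] _ /QP[M hM]; exists (maxn N M) => n.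
  rewrite geq_max => /andP[/hN hu /hM hv] /=.
  by apply/flatten_mapP; exists u => //; apply: map_f.
- move=> c d t u v _ /QP[N hN] _ /QP[M hM]; exists (maxn N M) => n.
  rewrite geq_max => /andP[/hN hu /hM hv] /=.
  by apply/flatten_mapP; exists u.
- move=> b c d t v _ /QP[N hN] _ /QP[M hM]; exists (maxn N M) => n.
  rewrite geq_max => /andP[/hN hu /hM hv] /=.
  by apply/flatten_mapP; exists Leaf.
- move=> b c d t u u' v _ /QP[N hN] _ /QP[M hM]; exists (maxn N M) => n.
  rewrite geq_max => /andP[/hN hu /hM hv] /=.
  by apply/flatten_mapP; exists (Node u u').
- move=> c d t _ /QP[N hN]; exists N.+1 => n [//|k] Nn _.
  rewrite iterSr; apply: iter_loop_done => //=.
  apply/flatten_mapP; exists (false, t); first by rewrite inE.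
  apply/flatten_mapP; exists Leaf; last by rewrite inE.
  exact/hN/ltnW.
- move=> c d t u u' t' v _ /QP[N hN] _ /QP[M hM] _ [K hK].
  exists (maxn (maxn N M) K).+1 => n [//|k] /ltnW; rewrite !geq_max.
  move=> /andP[/andP[/hN hu /hM hv] Kn]; rewrite ltnS !geq_max => /andP[_ Kk].
  have h := hK _ _ Kn Kk; rewrite iterSr.
  have hsub : forall s s' : seq (bool * tree), {subset s <= s'} ->
    {subset loop_step (run c n) (run d n) s <= loop_step (run c n) (run d n) s'}.
    move=> s s' ss x /flatten_mapP[y /ss ys hx].
    by apply/flatten_mapP; exists y.
  have hiter : forall j s s', {subset s <= s'} ->
    {subset iter j (loop_step (run c n) (run d n)) s <= iter j (loop_step (run c n) (run d n)) s'}.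
    by elim=> [|j IH] s s' ss //=; apply: hsub; apply: IH.
  apply: hiter h => x; rewrite inE => /eqP ->.
  apply/flatten_mapP; exists (false, t); first by rewrite inE.
  apply/flatten_mapP; exists (Node u u') => //=.
  by apply: map_f.
Qed.

(** * Enumerating the outputs of a machine *)

Definition strings (n : nat) : seq str :=
  iter n (fun l => map (cons false) l ++ map (cons true) l) [:: [::]].

Lemma size_strings n : size (strings n) = 2 ^ n.
Proof.
elim: n => //= n IH; rewrite size_cat !size_map -/(strings n) IH.
by rewrite expnS mul2n addnn.
Qed.

Lemma mem_strings n s : (s \in strings n) = (size s == n).
Proof.
elim: n s => [|n IH] s; first by rewrite inE; case: s.
rewrite /strings iterS -/(strings n) mem_cat.
case: s => [|b s]; first by apply/negbTE; rewrite negb_or; apply/andP; split; apply/mapP => -[].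
have inj b' : injective (cons b' : str -> str) by move=> ? ? [].
have ne b1 b2 : b1 != b2 -> b1 :: s \in map (cons b2) (strings n) = false.
  by move=> hb; apply/negbTE/mapP => -[s' _ [e _]]; rewrite e eqxx in hb.
by case: b; [rewrite (ne true false) | rewrite (ne false true) ?orbF] => //=; rewrite (mem_map (inj _)) IH.
Qed.

Lemma cmp_strings G `{encodable G} (n : G -> nat) :
  computable n -> computable (fun g => strings (n g)).
Proof.
move=> hn; rewrite /strings; cmp.
Qed.

Definition outputs (U : prog) (i : nat) (y : str) (n : nat) : seq str :=
  flatten [seq [seq str_of_tree v |
    v <- run U n (Node (tree_of_str p) (tree_of_str y))] | p <- strings i].

(** Weaker than [runs]: every result tree is read as a string. This may enlarge an enumeration, but
    a program still yields at most one string, which is all that counting uses. *)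
Definition yields (U : prog) (y p z : str) :=
  exists2 v, exec U (Node (tree_of_str p) (tree_of_str y)) v & z = str_of_tree v.

Lemma yields_fun U y p z z' : yields U y p z -> yields U y p z' -> z = z'.
Proof. by move=> [v hv ->] [w hw ->]; rewrite (exec_fun hv hw). Qed.

Lemma mem_outputs U i y n z :
  z \in outputs U i y n -> exists2 p, size p = i & yields U y p z.
Proof.
move=> /flatten_mapP[p]; rewrite mem_strings => /eqP hp /mapP[v /run_sound hv ->].
by exists p => //; exists v.
Qed.

Lemma outputs_mem U p y z :
  runs U p y z ->
  exists N, forall n, N <= n -> z \in outputs U (size p) y n.
Proof.
move=> /run_complete[N hN]; exists N => n /hN h.
apply/flatten_mapP; exists p; first by rewrite mem_strings.
by rewrite -[z]tree_of_strK; apply: map_f.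
Qed.

Lemma cmp_outputs U G `{encodable G} (i : G -> nat) (y : G -> str) (n : G -> nat) :
  computable i -> computable y -> computable n ->
  computable (fun g => outputs U (i g) (y g) (n g)).
Proof.
move=> hi hy hn; rewrite /outputs; cmp.
- by apply: cmp_str_of_tree; cmp.
- by apply: cmp_run; cmp.
- by apply: cmp_strings; cmp.
Qed.

(** Choosing a description of length [n] for each entry is injective, because a description
    determines what it describes. *)
Lemma size_described (T : eqType) (P : str -> T -> Prop) n (s : seq T) :
  (forall p z z', P p z -> P p z' -> z = z') -> uniq s ->
  (forall z, z \in s -> exists2 p, size p = n & P p z) -> size s <= 2 ^ n.
Proof.
move=> Pfun us h.
pose f z := if pselect (exists2 p, size p = n & P p z) is left e then projT1 (cid2 e) else [::].
have fP z : z \in s -> size (f z) = n /\ P (f z) z.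
  by move=> /h e; rewrite /f; case: pselect => // e'; case: cid2.
rewrite -(size_map f) -size_strings; apply: uniq_leq_size.
  rewrite map_inj_in_uniq // => z z' /fP[_ hz] /fP[_ hz'] e.
  by apply: Pfun hz _; rewrite e.
by move=> _ /mapP[z /fP[hz _] ->]; rewrite mem_strings hz.
Qed.

Definition append_new (a l : seq str) : seq str :=
  foldl (fun a x => if x \in a then a else rcons a x) a l.

(** New entries are only appended, so an entry keeps its position for ever and can be described by
    it. *)
Fixpoint enum (L : nat -> seq str) (n : nat) : seq str :=
  if n is k.+1 then append_new (enum L k) (L k) else [::].

Lemma mem_append_new a l x : (x \in append_new a l) = (x \in a) || (x \in l).
Proof.
elim: l a => [|y l IH] a /=; first by rewrite orbF.
rewrite IH inE; case: ifP => ya; last by rewrite mem_rcons inE -!orbA orbCA.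
by case: eqP => [->|//]; rewrite ya.
Qed.

Lemma prefix_append_new a l : prefix a (append_new a l).
Proof.
elim: l a => [|y l IH] a /=; first exact: prefix_refl.
case: ifP => _ //; apply: prefix_trans (IH _).
exact: prefix_rcons.
Qed.

Lemma uniq_append_new a l : uniq a -> uniq (append_new a l).
Proof.
elim: l a => [|y l IH] a //= ua; case: ifP => ya; apply: IH => //.
by rewrite rcons_uniq ya.
Qed.

Lemma uniq_enum L n : uniq (enum L n).
Proof. by elim: n => //= n; exact: uniq_append_new. Qed.

Lemma prefix_enum L m n : m <= n -> prefix (enum L m) (enum L n).
Proof.
move=> /subnKC <-; elim: (n - m) => [|k IH]; first by rewrite addn0 prefix_refl.
by rewrite addnS; apply: prefix_trans IH _; exact: prefix_append_new.
Qed.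

Lemma enumP L n x : reflect (exists2 k, k < n & x \in L k) (x \in enum L n).
Proof.
apply: (iffP idP).
  elim: n => //= n IH; rewrite mem_append_new => /orP[/IH [k kn xk]|xn].
    by exists k => //; exact: ltnW.
  by exists n.
move=> [k kn xk]; elim: n kn => // n IH; rewrite ltnS leq_eqVlt mem_append_new.
by case/orP => [/eqP <-|/IH ->] //; rewrite xk orbT.
Qed.

Lemma cmp_enum G `{encodable G} (L : G -> nat -> seq str) (n : G -> nat) :
  computable2 L -> computable n -> computable (fun g => enum (L g) (n g)).
Proof.
move=> hL hn.
pose st g (p : nat * seq str) := (p.1.+1, append_new p.2 (L g p.1)).
apply: (@eq_computable _ _ _ _ (fun g => (iter (n g) (st g) (0, [::])).2)); last first.
  by cmp; rewrite /st /append_new; cmp.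
move=> g; suff -> : iter (n g) (st g) (0, [::]) = (n g, enum (L g) (n g)) by [].
by elim: (n g) => //= k ->.
Qed.

Ltac cmp_ext3 :=
  lazymatch goal with
  | |- computable (fun g => is_leaf (@?a g)) => apply cmp_is_leaf
  | |- computable (fun g => str_of_tree (@?a g)) => apply cmp_str_of_tree
  | |- computable (fun g => strings (@?a g)) => apply cmp_strings
  | |- computable (fun g => run ?c (@?n g) (@?a g)) => apply cmp_run
  | |- computable (fun g => outputs ?c (@?n g) (@?a g) (@?b g)) => apply cmp_outputs
  | |- computable (fun g => enum (@?a g) (@?b g)) => apply (cmp_enum (L := a))
  end.
Ltac cmp_ext ::= first [cmp_ext1 | cmp_ext2 | cmp_ext3].

(** * Complexity bounds from enumerations *)

(** The state holds the finished strings, the current string, and whether the next bit is a data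
    bit. Any string decodes to some list. *)
Definition decode_step (st : seq str * str * bool) (b : bool) : seq str * str * bool :=
  if st.2 then (st.1.1, rcons st.1.2 b, false)
  else if b then (st.1, true)
  else (rcons st.1.1 st.1.2, [::], false).

Definition decode_list (p : str) : seq str :=
  (foldl decode_step ([::], [::], false) p).1.1.

Lemma foldl_decode_str acc cur s t :
  foldl decode_step (acc, cur, false) (encode_str s ++ t) =
  foldl decode_step (rcons acc (cur ++ s), [::], false) t.
Proof.
rewrite /encode_str; elim: s cur => [|b s IH] cur /=; first by rewrite cats0.
by rewrite IH /= cat_rcons.
Qed.

Lemma encode_listK l : decode_list (encode_list l) = l.
Proof.
rewrite /decode_list /encode_list.
suff h acc : foldl decode_step (acc, [::], false) (flatten (map encode_str l)) =
  (acc ++ l, [::], false) by rewrite h.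
elim: l acc => [|s l IH] acc /=; first by rewrite cats0.
by rewrite foldl_decode_str IH cat_rcons.
Qed.

Lemma cmp_decode_list G `{encodable G} (p : G -> str) :
  computable p -> computable (fun g => decode_list (p g)).
Proof. by move=> hp; rewrite /decode_list; cmp; rewrite /decode_step; cmp. Qed.

Lemma size_encode_str s : size (encode_str s) = (size s).*2.+1.
Proof.
rewrite /encode_str size_cat /= addn1.
by congr _.+1; elim: s => //= b s ->; rewrite doubleS.
Qed.

Lemma cmp_encode_list G `{encodable G} (l : G -> seq str) :
  computable l -> computable (fun g => encode_list (l g)).
Proof. by move=> hl; rewrite /encode_list /encode_str; cmp. Qed.

(** This lets the members of coded sets be searched for among finitely many short strings. *)
Lemma size_mem_decode_list (p s : str) : s \in decode_list p -> size s <= size p.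
Proof.
rewrite /decode_list.
suff h acc cur f : {in acc, forall s, size s <= size p} ->
   forall q, size cur + size q <= size p ->
   {in (foldl decode_step (acc, cur, f) q).1.1, forall s, size s <= size p}.
  by apply: (h [::] [::] false).
move=> hacc q; elim: q acc cur f hacc => [|b q IH] acc cur f hacc //= hs.
rewrite {2}/decode_step /=; case: f.
  by apply: IH => //; rewrite size_rcons addSnnS.
case: b; first by apply: IH => //; apply: leq_trans hs; rewrite leq_add2l.
apply: IH => [x|]; last by rewrite add0n; apply: leq_trans hs; rewrite addnS ltnW // ltnS leq_addl.
rewrite mem_rcons inE => /orP[/eqP ->|/hacc //].
by apply: leq_trans hs; rewrite leq_addr.
Qed.

(** * Fixed-width numerals and self-delimiting programs *)

Fixpoint nat_to_bits (w a : nat) : str :=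
  if w is w'.+1 then rcons (nat_to_bits w' a./2) (odd a) else [::].

Definition bits_to_nat (s : str) : nat :=
  foldl (fun n b => if b then (n + n).+1 else n + n) 0 s.

Lemma size_nat_to_bits w a : size (nat_to_bits w a) = w.
Proof. by elim: w a => //= w IH a; rewrite size_rcons IH. Qed.

Lemma nat_to_bitsK w a : a < 2 ^ w -> bits_to_nat (nat_to_bits w a) = a.
Proof.
elim: w a => [|w IH] a; first by rewrite expn0 ltnS leqn0 => /eqP.
rewrite expnS mul2n => ha; rewrite /= /bits_to_nat -cats1 foldl_cat /= -/(bits_to_nat _).
rewrite IH; last by rewrite -ltn_double (leq_ltn_trans _ ha) // -[leqRHS]odd_double_half leq_addl.
by rewrite addnn -[RHS]odd_double_half; case: (odd a).
Qed.

Lemma cmp_bits_to_nat G `{encodable G} (s : G -> str) :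
  computable s -> computable (fun g => bits_to_nat (s g)).
Proof. by move=> hs; rewrite /bits_to_nat; cmp. Qed.

(* A program is [encode_str w ++ idx]. The state records whether the end of
   [encode_str w] has been reached, whether a bit of [w] is expected next, and
   the parts of [w] and [idx] that have been read. *)
Definition parse_step (st : bool * bool * str * str) (b : bool) :=
  if st.1.1.1 then (st.1, rcons st.2 b)
  else if st.1.1.2 then ((false, false, rcons st.1.2 b), st.2)
  else if b then ((false, true, st.1.2), st.2)
  else ((true, false, st.1.2), st.2).

Definition parse (p : str) := foldl parse_step (false, false, [::], [::]) p.

Lemma foldl_parse_done (st : bool * bool * str * str) (s : str) :
  st.1.1.1 -> foldl parse_step st s = (st.1, st.2 ++ s).
Proof.
elim: s st => [|b s IH] [[[d f] w] i] /= hd; first by rewrite cats0.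
by rewrite hd /parse_step /= IH //= cat_rcons.
Qed.

Lemma parse_encode w i : parse (encode_str w ++ i) = (true, false, w, i).
Proof.
suff h cur : foldl parse_step (false, false, cur, [::]) (encode_str w ++ i) =
  (true, false, cur ++ w, i) by rewrite /parse h.
rewrite /encode_str; elim: w cur => [|b w IH] cur /=; last by rewrite IH cat_rcons.
by rewrite foldl_parse_done // cats0.
Qed.

Lemma cmp_parse G `{encodable G} (p : G -> str) :
  computable p -> computable (fun g => parse (p g)).
Proof. by move=> hp; rewrite /parse; cmp; rewrite /parse_step; cmp. Qed.

Ltac cmp_ext4 :=
  lazymatch goal with
  | |- computable (fun g => decode_list (@?a g)) => apply cmp_decode_list
  | |- computable (fun g => encode_list (@?a g)) => apply cmp_encode_list
  | |- computable (fun g => bits_to_nat (@?a g)) => apply cmp_bits_to_nat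
  | |- computable (fun g => parse (@?a g)) => apply cmp_parse
  end.
Ltac cmp_ext ::= first [cmp_ext1 | cmp_ext2 | cmp_ext3 | cmp_ext4].

Lemma Kcond_le U p y z : runs U p y z -> Kcond U z y <= size p.
Proof.
move=> h; rewrite /Kcond; case: pselect => [e|[]]; last first.
  by exists (size p); apply/asboolP; exists p.
by case: ex_minnP => m _; apply; apply/asboolP; exists p.
Qed.

Lemma Kcond_ex U p y z :
  runs U p y z -> exists2 q, size q = Kcond U z y & runs U q y z.
Proof.
move=> h; rewrite /Kcond; case: pselect => [e|[]]; last first.
  by exists (size p); apply/asboolP; exists p.
by case: ex_minnP => m /asboolP.
Qed.

(** * A prefix machine that outputs a given entry of an enumeration *)

Section Machine.
Variable L : seq nat -> str -> nat -> seq str.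
Hypothesis hL : computable (fun p : seq nat * str * nat => L p.1.1 p.1.2 p.2).

(** In a program [encode_str w ++ i], the header [w] codes numbers: first the length of [i], then
    the parameters of [L]. The numeral [i] is the position of the output in the enumeration. *)
Let nums (g : str * str) := [seq bits_to_nat s | s <- decode_list (parse g.1).1.2].
Let idx (g : str * str) := bits_to_nat (parse g.1).2.
Let wf (g : str * str) :=
  (parse g.1).1.1.1 && (size (parse g.1).2 == head 0 (nums g)).
Let list (g : str * str) (n : nat) := enum (L (behead (nums g)) g.2) n.
Let stop (p : str * str * nat) := idx p.1 < size (list p.1 p.2).
Let out (p : str * str * nat) := nth [::] (list p.1 p.2) (idx p.1).

Let cmp_list : computable (fun p : str * str * nat => list p.1 p.2).
Proof.
apply: (cmp_enum (L := fun p : str * str * nat => L (behead (nums p.1)) p.1.2)); last by cmp.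
apply: (cmp_comp (a := fun p : str * str * nat * nat =>
  ((behead (nums p.1.1), p.1.1.2), p.2)) hL).
by rewrite /nums; cmp.
Qed.

Let search (c d : prog) g n :
  (forall p, exec c (code p) (code (~~ stop p))) ->
  (forall p : str * str * nat, exec d (code p) (code (p.1, p.2.+1))) ->
  stop (g, n) -> exists2 m, m <= n & stop (g, m) /\
    exec (PWhile c d) (code (g, 0)) (code (g, m)).
Proof.
move=> hc hd; have loop k j : k + j = n -> stop (g, n) ->
    exists2 m, m <= n & stop (g, m) /\ exec (PWhile c d) (code (g, j)) (code (g, m)).
  elim: k j => [|k IH] j e hs.
    exists n => //; split=> //; have -> : j = n := e.
    by apply: ev_while_stop; have := hc (g, n); rewrite hs.
  have := hc (g, j); case hj: (stop (g, j)) => hcj.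
    exists j; first by rewrite -e leq_addl.
    by split=> //; apply: ev_while_stop.
  have [|m mn [sm em]] := IH j.+1 _ hs; first by rewrite -e addnS addSn.
  exists m => //; split=> //.
  exact: ev_while_step hcj (hd (g, j)) em.
by apply: (loop n 0); rewrite addn0.
Qed.

(* Ill-formed programs make the machine return a tree that codes no string. *)
Lemma listing_machine : exists M, prefix_machine M /\
  forall w i y n z, size i = head 0 [seq bits_to_nat s | s <- decode_list w] ->
    nth [::] (enum (L (behead [seq bits_to_nat s | s <- decode_list w]) y) n)
        (bits_to_nat i) = z ->
    bits_to_nat i < size (enum (L (behead [seq bits_to_nat s | s <- decode_list w]) y) n) ->
    runs M (encode_str w ++ i) y z.
Proof.
have [cwf hwf] : computable wf by rewrite /wf /nums; cmp.
have [cns hns] : computable (fun p => ~~ stop p).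
  have h := cmp_list; rewrite /stop /idx; cmp.
have [cinc hinc] : computable (fun p : str * str * nat => (p.1, p.2.+1)) by cmp.
have [cout hout] : computable out.
  by have h := cmp_list; rewrite /out /idx; cmp.
have [cini hini] : computable (fun g : str * str => (g, 0)) by cmp.
pose bad := Node (Node (Node Leaf Leaf) Leaf) Leaf.
have [cbad hbad] : computable (fun _ : str * str => bad) by cmp.
pose M := PIf cwf (PComp cout (PComp (PWhile cns cinc) cini)) cbad.
have badP p y z : runs M p y z -> wf (p, y).
  rewrite /runs => h; have hw := hwf (p, y).
  inversion h; subst.
    case: (wf (p, y)) hw => // hw.
    have := exec_fun (hbad (p, y)) H5.
    by case: (z) => [|[] s].
  have := exec_fun hw H4; by case: (wf (p, y)).
exists M; split.
  move=> y p q z z' /badP /andP[/= hp1 /eqP hp2] /badP /andP[/= hq1 /eqP hq2] /prefixP[s e].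
  (* Bits appended after the header only lengthen the index, whose length is fixed by the common
     header; hence [s] is empty. *)
  move: hq2; rewrite /nums e /parse /= foldl_cat -/(parse p) foldl_parse_done //=.
  rewrite size_cat hp2 -[in RHS](addn0 (head _ _)) => /addnI /size0nil ->.
  by rewrite cats0.
move=> w i y n z hi hz hn; rewrite /runs.
set p := encode_str w ++ i; pose g : str * str := (p, y).
have eg : parse g.1 = (true, false, w, i) by exact: parse_encode.
have ei : idx g = bits_to_nat i by rewrite /idx eg.
have el k : list g k = enum (L (behead [seq bits_to_nat s | s <- decode_list w]) y) k.
  by rewrite /list /nums eg.
have hw : wf g by rewrite /wf /nums eg /= hi.
have hs : stop (g, n) by rewrite /stop /= ei el.
have [m mn [sm em]] := search hns hinc hs.
have -> : z = out (g, m).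
  rewrite -hz /out /= ei el.
  (* The search may stop before stage [n], but the entry at this position is then already the final
     one. *)
  have /prefixP[t ->] := prefix_enum (L (behead [seq bits_to_nat s | s <- decode_list w]) y) mn.
  by rewrite nth_cat; move: sm; rewrite /stop /= ei el => ->.
apply: ev_if_true; first by have := hwf g; rewrite hw; exact.
exact: ev_comp (ev_comp (hini g) em) (hout (g, m)).
Qed.

End Machine.

Section Universal.
Variable U : prog.
Hypothesis hU : universal_prefix_machine U.

(** The position of [z] costs [r] bits, and the numbers [r] and [v] are written in the header with
    width [t]. The constant depends on [L] only. *)
Theorem Kcond_enum (L : seq nat -> str -> nat -> seq str) :
  computable (fun p : seq nat * str * nat => L p.1.1 p.1.2 p.2) ->
  exists c, forall t r v y n z, all (fun a => a < 2 ^ t) (r :: v) ->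
    (forall n, size (enum (L v y) n) <= 2 ^ r) -> z \in L v y n ->
    exists2 p, size p <= r + c * ((size v).+1 * t.+1) & runs U p y z.
Proof.
move=> /listing_machine[M [Mp hM]]; have [w0 hw0] := hU.2 _ Mp.
(* The header takes [4 t + 2] bits per number and one more bit, as both encodings double the
   length. *)
exists (size w0 + 6) => t r v y n z hv hb hz.
pose w := encode_list [seq nat_to_bits t a | a <- r :: v].
have ew : [seq bits_to_nat s | s <- decode_list w] = r :: v.
  rewrite encode_listK -map_comp map_id_in // => a /(allP hv) /=.
  exact: nat_to_bitsK.
have zn : z \in enum (L v y) n.+1 by apply/enumP; exists n.
pose i := nat_to_bits r (index z (enum (L v y) n.+1)).
have ei : bits_to_nat i = index z (enum (L v y) n.+1).
  by apply: nat_to_bitsK; apply: leq_trans (hb n.+1); rewrite index_mem.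
exists (w0 ++ (encode_str w ++ i)); last first.
  apply: hw0; apply: (hM _ _ _ n.+1); rewrite ew ?size_nat_to_bits ?ei //.
    by rewrite nth_index.
  by rewrite index_mem.
rewrite 2!size_cat size_encode_str size_nat_to_bits.
have -> : size w = (size v).+1 * t.*2.+1.
  rewrite /w /encode_list size_flatten /shape -!map_comp.
  rewrite (eq_map (g := fun=> t.*2.+1)); last first.
    by move=> a /=; rewrite size_encode_str size_nat_to_bits.
  by rewrite sumnE big_map big_const_seq count_predT iter_addn_0 mulnC.
nia.
Qed.

End Universal.

(** * Counting strings and sets *)

Lemma leq_expn_div a b c : a * 2 ^ b <= 2 ^ c -> a <= 2 ^ (c - b).
Proof.
case: (leqP b c) => [bc|cb] h.
  by rewrite -(leq_pmul2r (expn_gt0 2 b)) -expnD subnK.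
(* For [c < b] the hypothesis forces [a = 0], so truncating the exponent does no harm. *)
have : a * 2 ^ b < 1 * 2 ^ b by rewrite mul1n (leq_ltn_trans h) // ltn_exp2l.
by rewrite ltn_pmul2r ?expn_gt0 // ltnS leqn0 => /eqP ->.
Qed.

Lemma double_count (T1 T2 : eqType) (R : T1 -> T2 -> bool) (s1 : seq T1) (s2 : seq T2) :
  \sum_(x <- s1) count (R x) s2 = \sum_(y <- s2) count (R^~ y) s1.
Proof.
under eq_bigr do rewrite -sum1_count big_mkcond.
rewrite exchange_big /=; apply: eq_bigr => y _.
by rewrite -big_mkcond sum1_count.
Qed.

Lemma sum_seq_const (T : Type) (s : seq T) n : \sum_(x <- s) n = size s * n.
Proof. by rewrite big_const_seq count_predT iter_addn_0 mulnC. Qed.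

Lemma leq_count_sum (T1 T2 : eqType) (R : T1 -> T2 -> bool) (s1 : seq T1) (s2 : seq T2) a b :
  {in s1, forall x, a <= count (R x) s2} ->
  {in s2, forall y, count (R^~ y) s1 <= b} -> size s1 * a <= size s2 * b.
Proof.
move=> h1 h2; apply: (@leq_trans (\sum_(x <- s1) count (R x) s2)).
  by rewrite -sum_seq_const big_seq [leqRHS]big_seq leq_sum.
rewrite double_count -sum_seq_const.
by rewrite big_seq [leqRHS]big_seq leq_sum.
Qed.

Lemma count_mem_leq (T : eqType) (s t : seq T) : uniq s -> count (mem t) s <= size t.
Proof.
move=> us; rewrite -size_filter; apply: uniq_leq_size; first exact: filter_uniq.
by move=> x; rewrite mem_filter => /andP[].
Qed.

Lemma size_filter_notin (T : eqType) (s t : seq T) :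
  uniq s -> uniq t -> {subset t <= s} ->
  size [seq x <- s | x \notin t] + size t = size s.
Proof.
move=> us ut ts; rewrite -(count_predC (mem t) s) addnC size_filter.
congr (_ + _); rewrite -size_filter; apply: perm_size; apply: uniq_perm => //.
  exact: filter_uniq.
by move=> x; rewrite mem_filter /= andb_idr //; exact: ts.
Qed.

(** Transfers a size bound on the single stages of a growing enumeration to everything that is ever
    enumerated. *)
Lemma subset_stage (T : eqType) (L : nat -> seq T) (s : seq T) :
  (forall m n, m <= n -> {subset L m <= L n}) ->
  (forall x, x \in s -> exists n, x \in L n) -> exists n, {subset s <= L n}.
Proof.
move=> mono; elim: s => [|x s IH] h; first by exists 0.
have [|n hn] := IH; first by move=> y ys; apply: h; rewrite inE ys orbT.
have [m hm] := h x (mem_head _ _).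
exists (maxn m n) => y; rewrite inE => /orP[/eqP ->|/hn].
  by apply: mono hm; exact: leq_maxl.
by apply: mono; exact: leq_maxr.
Qed.

(** * Kept pairs and heavy sets *)

Definition occ (x : str) (ys : seq str) := count (fun y => x \in decode_list y) ys.

(* Only the part of [ys] up to [y] matters, so that the pairs once kept remain
   kept while [ys] is being enumerated. *)
Definition kept (k : nat) (ys : seq str) (y x : str) :=
  (x \in decode_list y) && (occ x (take (index y ys) ys) < 2 ^ k).

Definition kept_in k xs ys y := [seq x <- xs | kept k ys y x].

Definition heavy k l xs ys := [seq y <- ys | 2 ^ l <= size (kept_in k xs ys y)].

Lemma take_index_prefix (s t : seq str) y :
  prefix s t -> y \in s -> take (index y t) t = take (index y s) s.
Proof.
by move=> /prefixP[u ->] ys; rewrite index_cat ys take_cat index_mem ys.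
Qed.

(** If the last entry keeps [x], then fewer than [2 ^ k] earlier entries contain [x] at all. *)
Lemma count_kept k ys x : uniq ys -> count (kept k ys ^~ x) ys <= 2 ^ k.
Proof.
elim/last_ind: ys => [//|s y IH]; rewrite rcons_uniq => /andP[ys us].
rewrite -cats1 count_cat /= addn0.
have -> : count (kept k (s ++ [:: y]) ^~ x) s = count (kept k s ^~ x) s.
  apply: eq_in_count => z zs; rewrite /kept (@take_index_prefix s) //.
  exact: prefix_prefix.
case: (boolP (kept _ _ y x)) => [|_]; last by rewrite addn0; exact: IH.
move=> /andP[_]; rewrite index_cat (negbTE ys) /= eqxx addn0 take_size_cat //.
rewrite addn1; apply: leq_ltn_trans; rewrite /occ.
by apply: sub_count => z /andP[].
Qed.

(** Double counting of kept pairs: a heavy entry lies in at least [2 ^ l] of them, a string in at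
    most [2 ^ k]. *)
Lemma size_heavy k l xs ys :
  uniq xs -> uniq ys -> size (heavy k l xs ys) * 2 ^ l <= size xs * 2 ^ k.
Proof.
move=> ux uy; apply: (leq_count_sum (R := kept k ys)).
  by move=> y; rewrite mem_filter size_filter => /andP[].
move=> x _; apply: leq_trans (count_kept k x uy).
by rewrite /heavy count_filter; apply: sub_count => z /andP[].
Qed.

Lemma kept_prefix k ys ys' y x :
  prefix ys ys' -> y \in ys -> kept k ys' y x = kept k ys y x.
Proof. by move=> h yy; rewrite /kept (take_index_prefix h). Qed.

Lemma kept_in_mono k xs xs' ys ys' y :
  prefix xs xs' -> prefix ys ys' -> y \in ys ->
  prefix (kept_in k xs ys y) (kept_in k xs' ys' y).
Proof.
move=> /prefixP[u ->] hy yy; rewrite /kept_in filter_cat.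
rewrite !(@eq_filter _ (kept k ys' y) (kept k ys y)) => [|x|x]; try exact: kept_prefix.
exact: prefix_prefix.
Qed.

Lemma heavy_mono k l xs xs' ys ys' :
  prefix xs xs' -> prefix ys ys' -> {subset heavy k l xs ys <= heavy k l xs' ys'}.
Proof.
move=> hx hy y; rewrite !mem_filter => /andP[h yy]; rewrite (mem_infix (prefixW hy) yy) andbT.
exact: leq_trans h (size_prefix (kept_in_mono k hx hy yy)).
Qed.

(** A member of [y] is dropped only when [2 ^ k] entries before [y] contain it. *)
Lemma not_kept_occ k xs ys y x :
  x \in xs -> y \in ys -> x \in decode_list y -> x \notin kept_in k xs ys y ->
  2 ^ k <= occ x ys.
Proof.
move=> hx hy xy; rewrite mem_filter hx andbT /kept xy /= -leqNgt => /leq_trans; apply.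
by rewrite -[X in _ <= occ x X](cat_take_drop (index y ys)) /occ count_cat leq_addr.
Qed.

(** * Listings in lexicographic order, and blocks of frequent strings *)

Definition short_strings (n : nat) : seq str :=
  iter n (fun l => [::] :: map (cons false) l ++ map (cons true) l) [:: [::]].

Lemma mem_short_strings n s : (s \in short_strings n) = (size s <= n).
Proof.
elim: n s => [|n IH] s; first by rewrite inE; case: s.
rewrite /short_strings iterS -/(short_strings n) inE mem_cat; case: s => [|b s] //=.
rewrite ltnS -IH; have inj b' : injective (cons b' : str -> str) by move=> ? ? [].
have ne b1 b2 : b1 != b2 -> b1 :: s \in map (cons b2) (short_strings n) = false.
  by move=> hb; apply/negbTE/mapP => -[s' _ [e _]]; rewrite e eqxx in hb.
by case: b; [rewrite (ne true false) | rewrite (ne false true) ?orbF] => //=; rewrite (mem_map (inj _)).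
Qed.

Lemma sorted_short_strings n :
  sorted (fun s t => (s < t :> seqlexi bool)%O) (short_strings n).
Proof.
elim: n => // n IH; rewrite /short_strings iterS -/(short_strings n) /=.
have lt_cons b (s t : seq bool) :
    ((b :: s : seqlexi bool) < b :: t)%O = ((s : seqlexi bool) < t)%O.
  by rewrite ltxi_cons lexx.
have hs b : sorted (fun s t => (s < t :> seqlexi bool)%O) (map (cons b) (short_strings n)).
  by rewrite sorted_map; apply: sub_sorted IH => s t; rewrite /= lt_cons.
have tr : transitive (fun s t => (s < t :> seqlexi bool)%O) by exact: lt_trans.
rewrite path_sortedE //; apply/andP; split.
  by rewrite all_cat; apply/andP; split; apply/allP => _ /mapP[s _ ->].
move: (hs false) (hs true); rewrite !sorted_pairwise // pairwise_cat => -> ->.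
rewrite /= !andbT; apply/allrelP => _ _ /mapP[s _ ->] /mapP[t _ ->].
by rewrite ltxi_cons.
Qed.

Lemma cmp_short_strings G `{encodable G} (n : G -> nat) :
  computable n -> computable (fun g => short_strings (n g)).
Proof. by move=> hn; rewrite /short_strings; cmp. Qed.

Lemma listing_sorted (s : seq str) :
  sorted (fun s t => (s < t :> seqlexi bool)%O) s -> listing [fset x in s]%fset = s.
Proof.
move=> hs; have us : uniq s := @lt_sorted_uniq _ (seqlexi bool) _ hs.
apply: (@le_sorted_eq _ (seqlexi bool)).
- exact: (@sort_le_sorted _ (seqlexi bool)).
- by apply: sub_sorted hs => a b; exact: ltW.
- rewrite perm_sort; apply: uniq_perm => //; first exact: fset_uniq.
  by move=> x; rewrite !inE.
Qed.

Lemma mem_listing (S : {fset str}) x : (x \in listing S) = (x \in S).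
Proof. by rewrite mem_sort. Qed.

Lemma size_listing (S : {fset str}) : size (listing S) = #|` S|%fset.
Proof. by rewrite size_sort. Qed.

(* [b] counts the completed batches of [kap] entries of [ys]. Filtering the sorted
   list of all short strings gives sorted lists, which are listings of sets. *)
Definition rich (kap : nat) (ys : seq str) (b : nat) : seq str :=
  [seq z <- short_strings (sumn (map size (take (b * kap) ys))) |
    kap <= occ z (take (b * kap) ys)].

Definition fresh (kap : nat) (ys : seq str) (b : nat) : seq str :=
  [seq z <- rich kap ys b | z \notin rich kap ys b.-1].

Definition chunk (J : nat) (s : seq str) (q : nat) : seq str :=
  take J (drop (q * J) s).

(** The two filters stop at the last completed batch and leave out empty pieces. *)
Definition blocks (J kap : nat) (ys : seq str) : seq str :=
  flatten [seq [seq encode_list (chunk J (fresh kap ys b) q) |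
      q <- iota 0 (size (fresh kap ys b)) & q * J < size (fresh kap ys b)] |
    b <- iota 1 (size ys) & b * kap <= size ys].

Lemma sorted_rich kap ys b :
  sorted (fun s t => (s < t :> seqlexi bool)%O) (rich kap ys b).
Proof.
by apply: sorted_filter; [exact: (@lt_trans _ (seqlexi bool)) | exact: sorted_short_strings].
Qed.

Lemma uniq_rich kap ys b : uniq (rich kap ys b).
Proof. exact: (@lt_sorted_uniq _ (seqlexi bool) _ (sorted_rich kap ys b)). Qed.

(** The length bound in [rich] loses nothing: a string that occurs is no longer than the code in
    which it occurs. *)
Lemma mem_rich kap ys b z :
  0 < kap -> (z \in rich kap ys b) = (kap <= occ z (take (b * kap) ys)).
Proof.
move=> k0; rewrite mem_filter andb_idr // => h; rewrite mem_short_strings.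
have : has (fun y => z \in decode_list y) (take (b * kap) ys).
  by rewrite has_count; apply: leq_trans h.
move=> /hasP[y yt /size_mem_decode_list] /leq_trans; apply.
rewrite sumnE big_map; elim: (take _ _) yt => // a s IH.
rewrite inE big_cons => /orP[/eqP ->|/IH]; first exact: leq_addr.
by move=> /leq_trans; apply; exact: leq_addl.
Qed.

Lemma occ_take_mono z ys m n : m <= n -> occ z (take m ys) <= occ z (take n ys).
Proof.
move=> mn; rewrite -(subnKC mn) takeD /occ count_cat.
exact: leq_addr.
Qed.

Lemma rich_mono kap ys b b' :
  0 < kap -> b <= b' -> {subset rich kap ys b <= rich kap ys b'}.
Proof.
move=> k0 bb z; rewrite !mem_rich // => /leq_trans; apply.
by apply: occ_take_mono; rewrite leq_mul2r bb orbT.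
Qed.

Lemma rich0 kap ys : 0 < kap -> rich kap ys 0 = [::].
Proof.
move=> k0; apply/eqP; rewrite -size_eq0 -leqn0 leqNgt -has_predT; apply/negP => /hasP[z].
by rewrite mem_rich // mul0n take0 leqn0 => /eqP e; rewrite e in k0.
Qed.

(** Only completed batches are cut, and extending [ys] does not alter them. *)
Lemma blocks_mono J kap ys ys' :
  prefix ys ys' -> {subset blocks J kap ys <= blocks J kap ys'}.
Proof.
move=> /prefixP[u ->] c /flatten_mapP[b]; rewrite mem_filter mem_iota.
move=> /andP[hb /andP[b1 bn]].
have ht b' : b' <= b -> rich kap (ys ++ u) b' = rich kap ys b'.
  by move=> bb; rewrite /rich takel_cat // (leq_trans _ hb) // leq_mul2r bb orbT.
have -> : fresh kap ys b = fresh kap (ys ++ u) b by rewrite /fresh !ht // leq_pred.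
move=> hc; apply/flatten_mapP; exists b => //.
rewrite mem_filter mem_iota b1 size_cat; apply/andP; split; first by rewrite (leq_trans hb) ?leq_addr.
by rewrite (leq_trans bn) // leq_add2l leq_addr.
Qed.

(** A rich string stays rich, so the sum telescopes. *)
Lemma sum_size_fresh kap ys B : 0 < kap ->
  \sum_(b <- iota 1 B) size (fresh kap ys b) = size (rich kap ys B).
Proof.
move=> k0; elim: B => [|B IH]; first by rewrite big_nil rich0.
rewrite -(addn1 B) iotaD big_cat /= big_seq1 IH add1n addn1 addnC /fresh /=.
by rewrite size_filter_notin ?uniq_rich //; apply: rich_mono.
Qed.

Lemma size_rich J kap ys b :
  0 < kap -> {in ys, forall y, size (decode_list y) <= J} ->
  size (rich kap ys b) * kap <= size ys * J.
Proof.
move=> k0 hJ; apply: (leq_count_sum (R := fun z y => z \in decode_list y)).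
  move=> z; rewrite mem_rich // => /leq_trans; apply.
  by rewrite -[X in _ <= count _ X](cat_take_drop (b * kap)) count_cat leq_addr.
move=> y /hJ; apply: leq_trans.
exact: count_mem_leq (uniq_rich kap ys b).
Qed.

Lemma size_iota_lt J n : 0 < J -> size [seq q <- iota 0 n | q * J < n] <= (n %/ J).+1.
Proof.
move=> J0; rewrite -[leqRHS](size_iota 0); apply: uniq_leq_size.
  by rewrite filter_uniq ?iota_uniq.
move=> q; rewrite mem_filter !mem_iota /= add0n ltnS => /andP[h _].
by rewrite leq_divRL // ltnW.
Qed.

(** There are at most [size ys / kap] full pieces, because that many times [J] bounds the number of
    rich strings. Each of the [size ys / kap] batches adds at most one incomplete piece. *)
Lemma size_blocks J kap ys :
  0 < J -> 0 < kap -> {in ys, forall y, size (decode_list y) <= J} ->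
  size (blocks J kap ys) * kap <= 2 * size ys.
Proof.
move=> J0 k0 hJ; pose B := size ys %/ kap; pose f b := size (fresh kap ys b).
have eB : [seq b <- iota 1 (size ys) | b * kap <= size ys] = iota 1 B.
  apply: (irr_sorted_eq ltn_trans ltnn); rewrite ?iota_ltn_sorted //.
    by apply: sorted_filter (iota_ltn_sorted _ _); exact: ltn_trans.
  move=> b; rewrite mem_filter !mem_iota -leq_divRL // !add1n !ltnS -/B.
  case: (leqP b B) => bB; rewrite ?andbF //= (leq_trans bB (leq_div _ _)) //.
have h1 : size (blocks J kap ys) <= \sum_(b <- iota 1 B) (f b %/ J) + B.
  rewrite /blocks eB size_flatten /shape -map_comp sumnE big_map.
  rewrite -[X in _ + X](size_iota 1 B) -[X in _ + X]muln1 -sum_seq_const -big_split /=.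
  by apply: leq_sum => b _; rewrite size_map addn1; exact: size_iota_lt.
have h2 : (\sum_(b <- iota 1 B) (f b %/ J)) * J <= size (rich kap ys B).
  rewrite -sum_size_fresh // big_distrl /=.
  by apply: leq_sum => b _; exact: leq_trunc_div.
have h3 : (\sum_(b <- iota 1 B) (f b %/ J)) * kap <= size ys.
  rewrite -(leq_pmul2r J0) mulnAC (leq_trans _ (size_rich B k0 hJ)) //.
  by rewrite leq_mul2r h2 orbT.
have h4 : B * kap <= size ys := leq_trunc_div _ _.
apply: leq_trans (_ : (\sum_(b <- iota 1 B) (f b %/ J) + B) * kap <= _).
  by rewrite leq_mul2r h1 orbT.
by rewrite mulnDl mul2n -addnn leq_add.
Qed.

(* At the last checkpoint, [x] has at least [kap] of its [2 * kap] occurrences;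
   it is then fresh at the first checkpoint where it is rich. *)
Lemma blocks_cover J kap ys x :
  0 < J -> 0 < kap -> 2 * kap <= occ x ys ->
  exists2 s, encode_list s \in blocks J kap ys &
    [/\ x \in s, size s <= J & sorted (fun s t => (s < t :> seqlexi bool)%O) s].
Proof.
move=> J0 k0 hx; pose B := size ys %/ kap.
have hB : x \in rich kap ys B.
  rewrite mem_rich // -(leq_add2r kap) addnn -mul2n (leq_trans hx) //.
  rewrite -[X in occ x X](cat_take_drop (B * kap)) /occ count_cat leq_add2l.
  (* Fewer than [kap] entries follow the last checkpoint. *)
  apply: leq_trans (count_size _ _) _; rewrite size_drop /B leq_subLR.
  by rewrite {1}(divn_eq (size ys) kap) leq_add2l ltnW ?ltn_mod.
have ex : exists b, x \in rich kap ys b by exists B.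
case: (ex_minnP ex) => b hb bmin.
have bB : b <= B by exact: bmin.
have b0 : 0 < b by case: b hb {bmin bB} => //; rewrite rich0.
have xf : x \in fresh kap ys b.
  rewrite mem_filter hb andbT; apply/negP => /bmin.
  by rewrite leqNgt prednK // leqnn.
pose q := index x (fresh kap ys b) %/ J.
have qx : q * J <= index x (fresh kap ys b) := leq_trunc_div _ _.
have xi : index x (fresh kap ys b) < size (fresh kap ys b) by rewrite index_mem.
exists (chunk J (fresh kap ys b) q).
  have bk : b * kap <= size ys by rewrite -leq_divRL.
  apply/flatten_mapP; exists b.
    rewrite mem_filter mem_iota bk b0 add1n ltnS.
    by apply: leq_trans bk; rewrite leq_pmulr.
  apply: map_f; rewrite mem_filter mem_iota /= add0n (leq_ltn_trans qx xi) /=.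
  by apply: leq_ltn_trans xi; exact: leq_div.
split.
- have lt : index x (fresh kap ys b) - q * J < J.
    by rewrite ltn_subLR // [X in X < _](divn_eq _ J) ltn_add2l ltn_mod.
  have <- : nth [::] (chunk J (fresh kap ys b) q) (index x (fresh kap ys b) - q * J) = x.
    by rewrite nth_take // nth_drop subnKC // nth_index.
  by apply: mem_nth; rewrite size_take size_drop; case: ifP => // _; rewrite ltn_sub2r // (leq_ltn_trans qx).
- by rewrite size_take; case: ltnP.
- apply: take_sorted; apply: drop_sorted.
  by apply: sorted_filter (sorted_rich kap ys b); exact: (@lt_trans _ (seqlexi bool)).
Qed.

Lemma cmp_occ G `{encodable G} (x : G -> str) (ys : G -> seq str) :
  computable x -> computable ys -> computable (fun g => occ (x g) (ys g)).
Proof. by move=> hx hys; rewrite /occ; cmp. Qed.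

Ltac cmp_ext5 :=
  lazymatch goal with
  | |- computable (fun g => occ (@?a g) (@?b g)) => apply cmp_occ
  | |- computable (fun g => short_strings (@?a g)) => apply cmp_short_strings
  end.
Ltac cmp_ext ::= first [cmp_ext1 | cmp_ext2 | cmp_ext3 | cmp_ext4 | cmp_ext5].

Lemma cmp_kept_in G `{encodable G} (k : G -> nat) (xs ys : G -> seq str) (y : G -> str) :
  computable k -> computable xs -> computable ys -> computable y ->
  computable (fun g => kept_in (k g) (xs g) (ys g) (y g)).
Proof. by move=> hk hx hys hy; rewrite /kept_in /kept; cmp. Qed.

Lemma cmp_rich G `{encodable G} (kap : G -> nat) (ys : G -> seq str) (b : G -> nat) :
  computable kap -> computable ys -> computable b ->
  computable (fun g => rich (kap g) (ys g) (b g)).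
Proof. by move=> hk hys hb; rewrite /rich; cmp. Qed.

Ltac cmp_ext6 :=
  lazymatch goal with
  | |- computable (fun g => kept_in (@?a g) (@?b g) (@?c g) (@?d g)) => apply cmp_kept_in
  | |- computable (fun g => rich (@?a g) (@?b g) (@?c g)) => apply cmp_rich
  end.
Ltac cmp_ext ::= first [cmp_ext1 | cmp_ext2 | cmp_ext3 | cmp_ext4 | cmp_ext5 | cmp_ext6].

Lemma cmp_blocks G `{encodable G} (J kap : G -> nat) (ys : G -> seq str) :
  computable J -> computable kap -> computable ys ->
  computable (fun g => blocks (J g) (kap g) (ys g)).
Proof. by move=> hJ hk hys; rewrite /blocks /chunk /fresh; cmp. Qed.

Lemma cmp_heavy G `{encodable G} (k l : G -> nat) (xs ys : G -> seq str) :
  computable k -> computable l -> computable xs -> computable ys ->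
  computable (fun g => heavy (k g) (l g) (xs g) (ys g)).
Proof. by move=> hk hl hx hys; rewrite /heavy; cmp. Qed.

Ltac cmp_ext7 :=
  lazymatch goal with
  | |- computable (fun g => blocks (@?a g) (@?b g) (@?c g)) => apply cmp_blocks
  | |- computable (fun g => heavy (@?a g) (@?b g) (@?c g) (@?d g)) => apply cmp_heavy
  end.
Ltac cmp_ext ::= first [cmp_ext1 | cmp_ext2 | cmp_ext3 | cmp_ext4 | cmp_ext5 | cmp_ext6 | cmp_ext7].

(** * Information in a model *)

Section Bounds.
Variable U : prog.
Hypothesis hU : universal_prefix_machine U.

(** The size hypothesis speaks of arbitrary finite parts of what is ever listed, the form in which
    the counting arguments deliver it. *)
Theorem Kcond_list (L : seq nat -> str -> nat -> seq str) :
  computable (fun p : seq nat * str * nat => L p.1.1 p.1.2 p.2) ->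
  exists c, forall t r v y n z, all (fun a => a < 2 ^ t) (r :: v) ->
    (forall s, uniq s -> (forall x, x \in s -> exists n, x \in L v y n) ->
      size s <= 2 ^ r) ->
    z \in L v y n -> Kcond U z y <= r + c * ((size v).+1 * t.+1).
Proof.
move=> /(Kcond_enum hU)[c hc]; exists c => t r v y n z hv hs hz.
have [|p hp /Kcond_le] := hc t r v y n z hv _ hz.
  move=> m; apply: hs; first exact: uniq_enum.
  by move=> x /enumP[k _ xk]; exists k.
by move=> /leq_trans; apply.
Qed.

Lemma program_exists y z : exists p, runs U p y z.
Proof.
(* The bits of the string serve as parameters, and the enumeration has this string as its only
   entry. *)
have [|c hc] := @Kcond_enum U hU (fun v _ _ => [:: [seq a == 1 | a <- v]]).
  by cmp.
have [|n||p _ hp] := hc 1 0 (map nat_of_bool z) y 0 z; last by exists p.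
- by apply/andP; split=> //; apply/allP => _ /mapP[[] _ ->].
- rewrite expn0 -[1]/(size [:: [seq a == 1 | a <- map nat_of_bool z]]).
  apply: uniq_leq_size; first exact: uniq_enum.
  by move=> x /enumP[k _].
- by rewrite inE -map_comp map_id_in // => -[].
Qed.

Lemma Kcond_runs y z : exists2 p, size p = Kcond U z y & runs U p y z.
Proof. by have [p /Kcond_ex] := program_exists y z. Qed.

(* The empty program would be a prefix of the programs of two different strings. *)
Lemma Kcond_gt0 y z : 0 < Kcond U z y.
Proof.
have [p /eqP hp hr] := Kcond_runs y z; rewrite lt0n; apply/negP => /eqP e.
move: hp; rewrite e => /nilP hp; subst p.
have h z' : runs U [::] y z'.
  by have [q hq] := program_exists y z'; rewrite (hU.1 _ _ _ _ _ hr hq (prefix0s q)).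
by have := exec_fun (h [::]) (h [:: true]).
Qed.

(** The easy half of the chain rule: [x] is among the results of running a program of length [K(y)]
    and then, on its output, one of length [K(x|y)]. *)
Lemma Kcond_chain : exists c, forall t x y,
  Kcond U y [::] < 2 ^ t -> Kcond U x y < 2 ^ t ->
  Kcond U x [::] <= Kcond U y [::] + Kcond U x y + c * t.+1.
Proof.
pose L (v : seq nat) (_ : str) n :=
  flatten [seq outputs U (nth 0 v 1) y n | y <- outputs U (nth 0 v 0) [::] n].
have [|c hc] := @Kcond_list L; first by rewrite /L; cmp.
exists (c * 6) => t x y ht1 ht2.
have [p hp rp] := Kcond_runs [::] y; have [q hq rq] := Kcond_runs y x.
have [N hN] := outputs_mem rp; have [M hM] := outputs_mem rq.
(* Three numbers are written, with width [t.+1] because [r] is a sum of two numbers below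
   [2 ^ t]. *)
apply: leq_trans (_ : _ <= Kcond U y [::] + Kcond U x y + c * (3 * t.+2)) _; last first.
  by rewrite leq_add2l -mulnA leq_mul2l; apply/orP; right; lia.
apply: (hc t.+1 _ [:: size p; size q] _ (maxn N M)).
- by rewrite /= hp hq expnS; lia.
(* The concatenation of the two programs can be split again, as the length of the first is known. *)
- move=> s us hs; apply: (size_described
    (P := fun w z => exists p' q', [/\ w = p' ++ q', size p' = size p &
      exists2 u, yields U [::] p' u & yields U u q' z])) => //.
    move=> w z z' [p1 [q1 [-> s1 [u1 a1 b1]]]] [p2 [q2 [e s2 [u2 a2 b2]]]].
    move/eqP: e; rewrite eqseq_cat ?s1 // => /andP[/eqP ep /eqP eq]; subst.
    by move: b2; rewrite -(yields_fun a1 a2); apply: yields_fun.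
  move=> z /hs[n /flatten_mapP[u /mem_outputs[p' sp yp] /mem_outputs[q' sq yq]]].
  exists (p' ++ q'); first by rewrite size_cat sp sq /= hp hq.
  by exists p', q'; split=> //; exists u.
- apply/flatten_mapP; exists y; first by apply: hN; exact: leq_maxl.
  by apply: hM; exact: leq_maxr.
Qed.

Lemma Kgiven_card : exists c, forall t x (A : {fset str}), x \in A ->
  up_log 2 #|` A|%fset < 2 ^ t ->
  Kgiven U x A <= up_log 2 #|` A|%fset + c * t.+1.
Proof.
have [|c hc] := @Kcond_list (fun _ y _ => decode_list y); first by cmp.
exists c => t x A xA ht; rewrite -[t.+1]mul1n.
apply: (hc t _ [::] _ 0); first by rewrite /= ht.
- move=> s us hs; apply: leq_trans (up_logP _ _) => //.
  rewrite -size_listing; apply: uniq_leq_size => // z /hs[_].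
  by rewrite encode_listK.
- by rewrite encode_listK mem_listing.
Qed.

(** * Complexity of heavy sets, kept strings and blocks *)

Definition described (m n : nat) : seq str := enum (outputs U m [::]) n.

(** Entries are arbitrary strings read through [decode_list]; they may be unsorted and repeat
    elements. *)
Definition models_of (i j n : nat) : seq str :=
  enum (fun n => [seq y <- outputs U i [::] n | size (decode_list y) <= 2 ^ j]) n.

Lemma cmp_described G `{encodable G} (m n : G -> nat) :
  computable m -> computable n -> computable (fun g => described (m g) (n g)).
Proof. by move=> hm hn; rewrite /described; cmp. Qed.

Lemma cmp_models_of G `{encodable G} (i j n : G -> nat) :
  computable i -> computable j -> computable n ->
  computable (fun g => models_of (i g) (j g) (n g)).
Proof. by move=> hi hj hn; rewrite /models_of; cmp. Qed.

Ltac cmp_ext8 :=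
  lazymatch goal with
  | |- computable (fun g => described (@?a g) (@?b g)) => apply cmp_described
  | |- computable (fun g => models_of (@?a g) (@?b g) (@?c g)) => apply cmp_models_of
  end.
Ltac cmp_ext ::= first [cmp_ext1 | cmp_ext2 | cmp_ext3 | cmp_ext4 | cmp_ext5
  | cmp_ext6 | cmp_ext7 | cmp_ext8].

Lemma size_described_enum m n : size (described m n) <= 2 ^ m.
Proof.
apply: (size_described (P := yields U [::])); [exact: yields_fun | exact: uniq_enum |].
by move=> z /enumP[k _ /mem_outputs].
Qed.

Lemma size_models_of i j n : size (models_of i j n) <= 2 ^ i.
Proof.
apply: (size_described (P := yields U [::])); [exact: yields_fun | exact: uniq_enum |].
by move=> z /enumP[k _]; rewrite mem_filter => /andP[_ /mem_outputs].
Qed.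

Lemma models_of_card i j n : {in models_of i j n, forall y, size (decode_list y) <= 2 ^ j}.
Proof. by move=> y /enumP[k _]; rewrite mem_filter => /andP[]. Qed.

(** Heavy sets can be enumerated and number at most [2 ^ (m + k - l)]. The first conclusion makes
    this subtraction exact. *)
Lemma heavy_complexity : exists c, forall t i j m k l n y,
  all (fun a => a < 2 ^ t) [:: i; j; m; k; l] ->
  y \in heavy k l (described m n) (models_of i j n) ->
  l <= m + k /\ Kcond U y [::] <= m + k - l + c * t.+1.
Proof.
pose L (v : seq nat) (_ : str) n := heavy (nth 0 v 3) (nth 0 v 4)
  (described (nth 0 v 2) n) (models_of (nth 0 v 0) (nth 0 v 1) n).
have [|c hc] := @Kcond_list L; first by rewrite /L; cmp.
exists (c * 12) => t i j m k l n y hv hy.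
have size_bound n' : size (heavy k l (described m n') (models_of i j n')) * 2 ^ l <= 2 ^ (m + k).
  apply: leq_trans (size_heavy _ _ (uniq_enum _ _) (uniq_enum _ _)) _.
  by rewrite expnD leq_mul2r size_described_enum orbT.
split.
  rewrite -(@leq_exp2l 2) // (leq_trans _ (size_bound n)) // leq_pmull //.
  by case: heavy hy.
apply: leq_trans (_ : _ <= m + k - l + c * (6 * t.+2)) _; last first.
  by rewrite leq_add2l -mulnA leq_mul2l; apply/orP; right; lia.
apply: (hc t.+1 _ [:: i; j; m; k; l] _ n) => //.
  by move: hv; rewrite /= expnS; lia.
move=> s us hs; have [|n' hn'] := @subset_stage _ (L [:: i; j; m; k; l] [::]) s _ hs.
  by move=> a b ab; apply: heavy_mono; exact: prefix_enum.
apply: leq_trans (uniq_leq_size us hn') _.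
exact/leq_expn_div/size_bound.
Qed.

(** A set that never becomes heavy keeps fewer than [2 ^ l] strings, which can be enumerated from
    it; for [l = 0] it keeps none. *)
Lemma kept_complexity : exists c, forall t i j m k l n y x,
  all (fun a => a < 2 ^ t) [:: i; j; m; k; l] ->
  (forall n, y \notin heavy k l (described m n) (models_of i j n)) ->
  y \in models_of i j n ->
  x \in kept_in k (described m n) (models_of i j n) y ->
  0 < l /\ Kcond U x y <= l + c * t.+1.
Proof.
pose K (v : seq nat) (y : str) n := kept_in (nth 0 v 3)
  (described (nth 0 v 2) n) (models_of (nth 0 v 0) (nth 0 v 1) n) y.
pose L (v : seq nat) (y : str) n :=
  (* The position of [y] is settled only once [y] has appeared; listing nothing before makes the
     stages increase. *)
  if y \in models_of (nth 0 v 0) (nth 0 v 1) n then K v y n else [::].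
have [|c hc] := @Kcond_list L; first by rewrite /L /K; cmp.
exists (c * 5) => t i j m k l n y x hv hy yn xn.
pose v := [:: i; j; m; k].
have small n' : y \in models_of i j n' -> size (K v y n') < 2 ^ l.
  by move=> yn'; have := hy n'; rewrite mem_filter yn' andbT -ltnNge.
split.
  case: (l) small => // /(_ n yn); rewrite expn0 ltnS leqn0 size_eq0 => /eqP e.
  by move: xn; rewrite -/(K v y n) e.
rewrite -mulnA; apply: (hc t _ v _ n).
- by move: hv; rewrite /=; lia.
- move=> s us hs; have [|n' hn'] := @subset_stage _ (L v y) s _ hs.
    move=> a b ab z; rewrite /L; case: ifP => // ya.
    have hab := prefix_enum (fun n => [seq y <- outputs U i [::] n | size (decode_list y) <= 2 ^ j]) ab.
    rewrite (mem_infix (prefixW hab) ya) => hz.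
    apply: (mem_infix (prefixW _) hz).
    by apply: kept_in_mono; rewrite ?prefix_enum.
  apply: leq_trans (uniq_leq_size us hn') _; rewrite /L; case: ifP => // /small.
  exact: ltnW.
- by rewrite /L /= yn.
Qed.

Lemma blocks_complexity : exists c, forall t i j k n z,
  all (fun a => a < 2 ^ t) [:: i; j; k] ->
  z \in blocks (2 ^ j) (2 ^ k) (models_of i j n) ->
  Kcond U z [::] <= i.+1 - k + c * t.+1.
Proof.
pose L (v : seq nat) (_ : str) n := blocks (2 ^ nth 0 v 1) (2 ^ nth 0 v 2)
  (models_of (nth 0 v 0) (nth 0 v 1) n).
have [|c hc] := @Kcond_list L; first by rewrite /L; cmp.
exists (c * 8) => t i j k n z hv hz.
apply: leq_trans (_ : _ <= i.+1 - k + c * (4 * t.+2)) _; last first.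
  by rewrite leq_add2l -mulnA leq_mul2l; apply/orP; right; lia.
apply: (hc t.+1 _ [:: i; j; k] _ n) => //.
  by move: hv; rewrite /= expnS; lia.
move=> s us hs; have [|n' hn'] := @subset_stage _ (L [:: i; j; k] [::]) s _ hs.
  by move=> a b ab; apply: blocks_mono; exact: prefix_enum.
apply: leq_trans (uniq_leq_size us hn') _; apply: leq_expn_div.
apply: leq_trans (size_blocks _ _ (@models_of_card i j n')) _; rewrite ?expn_gt0 //.
by rewrite expnS leq_mul2l /= size_models_of.
Qed.

(** Shows that quantities derived from those below [2 ^ t] stay below [2 ^ (t + O(1))], so that all
    numerals have width [t + O(1)]. *)
Lemma ltn_exp_affine a b c t :
  a <= b + c * t.+1 -> b < 2 ^ t -> a < 2 ^ (t + c.+1).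
Proof.
move=> ab bt; have ht : t < 2 ^ t by exact: ltn_expl.
have hc : c.+1 < 2 ^ c.+1 by exact: ltn_expl.
apply: (@leq_trans (2 ^ t * c.+1)); last by rewrite expnD leq_mul2l ltnW ?orbT.
rewrite mulnS; apply: leq_ltn_trans ab _; rewrite -addSn.
by apply: leq_add => //; rewrite mulnC leq_mul2r ht orbT.
Qed.

(** The number [t] plays the role of [log Lambda(A)]. In the first conclusion the error depends on
    [t] only, however complex [y] is. *)
Theorem model_of_information : exists c, forall t x (A : {fset str}),
  x \in A -> Kset U A + up_log 2 #|` A|%fset < 2 ^ t ->
  (forall y, Kcond U x [::] <= Kcond U y [::] + Kcond U x y + c * t.+1) /\
  exists2 S : {fset str}, x \in S &
    Kset U S + Kgiven U x A <= Kcond U x [::] + c * t.+1 /\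
    #|` S|%fset <= 2 ^ up_log 2 #|` A|%fset.
Proof.
have [c1 h1] := heavy_complexity; have [c2 h2] := kept_complexity.
have [c3 h3] := blocks_complexity; have [c4 h4] := Kcond_chain.
have [c5 h5] := Kgiven_card.
(* The shift [d1] accounts for the bound on [l] by [j], and [d2] for the bound on [m] by [i + l],
   with one exponent to spare. *)
pose d1 := c5.+1; pose d2 := d1 + c4.+2.+1.
(* This uses [t + d2 + 1 <= (t + 1) (d2 + 1)]; the factor 4 covers errors that enter more than
   once. *)
exists ((c1 + c2 + c3 + c4 + 2) * 4 * d2.+1) => t x A xA hA.
set i := Kset U A in hA *; set j := up_log 2 _ in hA *.
set l := Kgiven U x A; set m := Kcond U x [::].
have pos a : 0 < 2 ^ a by rewrite expn_gt0.
have lt2 a : a < 2 ^ a by exact: ltn_expl.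
have hl : l < 2 ^ (t + d1).
  have hj : j < 2 ^ t by apply: leq_ltn_trans hA; exact: leq_addl.
  exact: ltn_exp_affine (h5 t x A xA hj) hj.
have hi : i < 2 ^ (t + d1).
  apply: leq_ltn_trans (leq_addr j i) (leq_trans hA _).
  by rewrite leq_exp2l // leq_addr.
have hm : m < 2 ^ (t + d2).-1.
  have -> : (t + d2).-1 = (t + d1).+1 + c4.+1 by rewrite /d2; lia.
  apply: (@ltn_exp_affine _ (i + l)).
    apply: leq_trans (h4 (t + d1) _ _ hi hl) _.
    by rewrite leq_add2l leq_mul2l leqnSn orbT.
  by rewrite expnS mul2n -addnn; lia.
set F := _ * t.+1.
have hF : 4 * (c1 * (t + d2).+1 + c2 * (t + d2).+1 + c3 * (t + d2).+1 +
    c4 * (t + d2).+1 + 2) <= F.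
  apply: (@leq_trans (4 * ((c1 + c2 + c3 + c4 + 2) * (t + d2).+1))).
    by rewrite leq_mul2l /= !mulnDl leq_add2l leq_pmulr.
  rewrite /F -mulnA -[_ * 4 * _]mulnA [4 * (_ * _)]mulnCA.
  by rewrite leq_mul2l; apply/orP; right; clear; nia.
split=> [y|].
  (* Either the bound is trivial, or both complexities are below [m], and the chain rule applies
     with a width independent of [y]. *)
  case: (leqP m (Kcond U y [::] + Kcond U x y)) => hy; first by rewrite (leq_trans hy) ?leq_addr.
  apply: leq_trans (h4 (t + d2).-1 x y _ _) _.
  - by apply: leq_ltn_trans hm; apply: leq_trans (ltnW hy); exact: leq_addr.
  - by apply: leq_ltn_trans hm; apply: leq_trans (ltnW hy); exact: leq_addl.
  - have h : c4 * (t + d2).-1.+1 <= c4 * (t + d2).+1.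
      by rewrite leq_mul2l; apply/orP; right; lia.
    lia.
set T := t + d2 in hm hF *; pose E := c1 * T.+1 + c2 * T.+1.
(* The values are just small enough: were [x] kept in [A], then [K(x|A) < l] would follow; were [A]
   heavy, then [K(A) < i]. *)
pose l' := l - E - 1; pose k := i + l' - m - E - 1.
have T0 : 0 < T by rewrite /T /d2 !addnS.
have hpow : 2 ^ T = 2 * 2 ^ T.-1 by rewrite -expnS prednK.
have hT1 a : a < 2 ^ (t + d1) -> a < 2 ^ T.-1.
  by move=> /leq_trans; apply; rewrite leq_exp2l // /T /d2; clear; lia.
have {}hi : i < 2 ^ T.-1 by exact: hT1.
have {}hl : l < 2 ^ T.-1 by exact: hT1.
have hj : j < 2 ^ T.-1.
  by apply: hT1; apply: leq_ltn_trans (leq_addl i j) (leq_trans hA _); rewrite leq_exp2l // leq_addr.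
have hall : all (fun a => a < 2 ^ T) [:: i; j; m; k; l'].
  have kil : k < 2 ^ T by rewrite hpow mul2n -addnn /k /l'; move: hi hl; clear; lia.
  have lT : l' < 2 ^ T.-1 by apply: leq_ltn_trans hl; rewrite /l' -subnDA leq_subr.
  have h a : a < 2 ^ T.-1 -> a < 2 ^ T by rewrite hpow; clear; lia.
  by rewrite /= kil !h.
case: (posnP k) => k0.
  (* For [k = 0] the truncated differences give [i + l <= m + 2 E + 2], so [A] itself serves. *)
  exists A => //; split; last exact: up_logP.
  by move: k0 hF; rewrite -/i -/l /k /l' /E; clear; lia.
have [p hp rp] := Kcond_runs [::] (encode_list (listing A)).
have [q hq rq] := Kcond_runs [::] x.
have [N hN] := outputs_mem rp; have [M hM] := outputs_mem rq.
pose n := (maxn N M).+1; set y := encode_list (listing A) in rp hN hp.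
have yn : y \in models_of i j n.
  apply/enumP; exists (maxn N M) => //; rewrite mem_filter encode_listK size_listing.
  by rewrite up_logP //= -[i]hp; apply: hN; exact: leq_maxl.
have xn : x \in described m n.
  apply/enumP; exists (maxn N M) => //.
  by rewrite -[m]hq; apply: hM; exact: leq_maxr.
have not_heavy n' : y \notin heavy k l' (described m n') (models_of i j n').
  apply/negP => /(h1 T)[] // lk; rewrite -/(Kset U A) -/i.
  by move: lk k0; rewrite /k /E; clear; lia.
have not_kept : x \notin kept_in k (described m n) (models_of i j n) y.
  apply/negP => /(h2 T _ _ _ _ _ _ _ _ hall not_heavy yn)[].
  by rewrite -/(Kgiven U x A) -/l /l' /E; clear; lia.
have occ_x : 2 ^ k <= occ x (models_of i j n).
  by apply: not_kept_occ xn yn _ not_kept; rewrite encode_listK mem_listing.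
(* This keeps the difference [i.+1 - k.-1] in the complexity of a block from being truncated. *)
have ki : k <= i.
  rewrite -(@leq_exp2l 2) // (leq_trans occ_x) // (leq_trans _ (size_models_of i j n)) //.
  exact: count_size.
have [|s sb [xs sJ ss]] := @blocks_cover (2 ^ j) (2 ^ k.-1) (models_of i j n) x (pos _) (pos _).
  by rewrite -expnS prednK.
exists [fset z in s]%fset; first by rewrite !inE.
rewrite -size_listing listing_sorted // sJ; split=> //.
have := h3 T i j k.-1 n _ _ sb; rewrite /Kset listing_sorted // => /(_ _) h.
have {}h := h _; apply: leq_trans (leq_add (h _) (leqnn _)) _.
  by move: hall => /and5P[ti tj _ tk _]; rewrite /= ti tj (leq_ltn_trans (leq_pred k) tk).
by move: k0 ki hF; rewrite -/l /k /l' /E; clear; lia.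
Qed.

End Bounds.

(** * Real-valued bounds *)

Local Open Scope ring_scope.

Section Logarithms.
Context {R : realType}.
Implicit Types r s : R.

Lemma ln2_gt0 : 0 < ln 2 :> R.
Proof. by rewrite ln_gt0 // ltr1n. Qed.

Lemma log2_le r s : 0 < r -> r <= s -> log2 r <= log2 s.
Proof.
move=> r0 rs; rewrite /log2 ler_pM2r ?invr_gt0 ?ln2_gt0 //.
by rewrite ler_ln ?posrE // (lt_le_trans r0).
Qed.

Lemma log2_exp n : log2 ((2 ^ n)%:R : R) = n%:R.
Proof.
rewrite /log2 natrX lnXn; last by rewrite ltr0n.
by rewrite mulrnAl divff // gt_eqF // ln2_gt0.
Qed.

Lemma log2M2 r : 0 < r -> log2 (2 * r) = 1 + log2 r.
Proof.
move=> r0; rewrite /log2 lnM ?posrE ?ltr0n // mulrDl divff //.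
by rewrite gt_eqF // ln2_gt0.
Qed.

Lemma up_log_log2 n : (0 < n)%N -> (up_log 2 n)%:R <= 1 + log2 n%:R :> R.
Proof.
move=> n0; rewrite -log2M2 ?ltr0n // -log2_exp; apply: log2_le.
  by rewrite ltr0n expn_gt0.
rewrite -natrM ler_nat; case: (ltnP 1 n) => n1; last first.
  by have -> : n = 1%N by apply/eqP; rewrite eqn_leq n1.
have /andP[/ltnW h _] := up_log_bounds (isT : (1 < 2)%N) n1.
by rewrite -[X in (2 ^ X)%N]prednK ?up_log_gt0 // expnS leq_mul2l.
Qed.

End Logarithms.

Section Reals.
Context {R : realType}.
Variable U : prog.

Lemma card_gt0 x (S : {fset str}) : x \in S -> (0 < #|` S|%fset)%N.
Proof. by rewrite cardfs_gt0 => xS; apply/fset0Pn; exists x. Qed.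

Lemma logcard_ge0 x (S : {fset str}) : x \in S -> 0 <= logcard S :> R.
Proof.
move=> xS; rewrite /logcard -[X in X <= _](log2_exp 0); apply: log2_le; first by rewrite ltr0n.
by rewrite ler_nat (card_gt0 xS).
Qed.

(** The minima [lambda] and [h] are used only through lower bounds on all models. The value [-oo] of
    [beta] is kept as a case, since it makes the right-hand sides [+oo]. *)
Lemma minima_cases x alpha :
  [/\ lambda_fun U x alpha = +oo :> \bar R, h_fun U x alpha = +oo :> \bar R &
      forall S, ~ models U x alpha S]%E \/
  exists l h : R, [/\ lambda_fun U x alpha = l%:E, h_fun U x alpha = h%:E,
    forall a, (forall S, models U x alpha S -> a <= Lambda U S) -> a <= l,
    forall a, (forall S, models U x alpha S -> a <= logcard S) -> a <= h &
    beta_fun U x alpha = -oo%E :> \bar R \/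
    exists2 b : R, beta_fun U x alpha = b%:E &
      forall S, models U x alpha S -> b <= deficiency U x S].
Proof.
have [[S0 hS0]|/forallNP hno] := pselect (exists S, models U x alpha S); last first.
  left; have e (f : {fset str} -> \bar R) :
      [set f S | S in models U x alpha]%classic = set0.
    by apply/seteqP; split=> // r [S /hno].
  by split=> //; rewrite /lambda_fun /h_fun e ereal_inf0.
right; have key (f : {fset str} -> R) :
    (forall S, models U x alpha S -> 0 <= f S) ->
    exists l : R, ereal_inf [set (f S)%:E | S in models U x alpha]%classic = l%:E /\
      forall a, (forall S, models U x alpha S -> a <= f S) -> a <= l.
  move=> f0; set I := ereal_inf _.
  have low a : (forall S, models U x alpha S -> a <= f S) -> (a%:E <= I)%E.
    by move=> ha; apply: le_ereal_inf_tmp => _ [S hS <-]; rewrite lee_fin ha.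
  have up : (I <= (f S0)%:E)%E by apply: ereal_inf_lbound; exists S0.
  case: I low up => [l|//|/(_ 0 f0) //] low _.
  by exists l; split=> // a /low; rewrite lee_fin.
have L0 S : models U x alpha S -> 0 <= Lambda U S :> R.
  by case=> xS _; rewrite addr_ge0 ?ler0n ?(logcard_ge0 xS).
have l0 S : models U x alpha S -> 0 <= logcard S :> R by case=> /logcard_ge0.
have [l [el hl]] := key _ L0; have [h [eh hh]] := key _ l0.
exists l, h; split=> //.
have up S : models U x alpha S -> (beta_fun U x alpha <= (deficiency U x S : R)%:E)%E.
  by move=> hS; apply: ereal_inf_lbound; exists S.
case: beta_fun up => [b|/(_ _ hS0) //|_]; last by left.
by move=> up; right; exists b => // S /up; rewrite lee_fin.
Qed.

End Reals.

(* The right-hand sides use the addition of [ereal_dual_scope], for which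
   [+oo - +oo = +oo]: when no [S] containing [x] has [K(S) <= alpha], the three
   bounds are [+oo]; otherwise all the quantities are finite. *)
Theorem mainTheorem5 (R : realType) (U : prog)
    (hU : universal_prefix_machine U) :
  exists C : R, forall (x : str) (alpha : nat) (A : {fset str}), x \in A ->
  exists S : {fset str}, x \in S /\
  let e : R := C * log2 (Lambda U A) in
  [/\ ((Lambda U S)%:E <=
        lambda_fun U x alpha + ((deficiency U x A)%:E - beta_fun U x alpha)
        + e%:E)%dE,
      ((Kset U S)%:R%:E <=
        (Kset U A)%:R%:E + (lambda_fun U x alpha - (Lambda U A)%:E)
        + ((deficiency U x A)%:E - beta_fun U x alpha) + e%:E)%dE
    & ((Kset U S)%:R%:E <=
        alpha%:R%:E + (h_fun U x alpha - (logcard A)%:E)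
        + ((deficiency U x A)%:E - beta_fun U x alpha) + e%:E)%dE].
Proof.
(* With [L = log Lambda(A) >= 1], the total loss [2 c (t + 1) + 1] is at most
   [2 c (L + 3) + 1 <= (8 c + 1) L]. *)
have [c hc] := model_of_information hU; exists (8 * c%:R + 1) => x alpha A xA.
set e := (8 * c%:R + 1) * _.
have [[-> -> _]|[l [h [-> -> hl hh hb]]]] := @minima_cases R U x alpha.
  exists A; split=> //=.
  have top (y : \bar R) : (+oo + y = +oo :> \bar R)%dE by case: y.
  have top' (y : \bar R) : (y + +oo = +oo :> \bar R)%dE by case: y.
  by split; rewrite ?(top, top') leey.
case: hb => [->|[b -> hb]].
  by exists A; split=> //=; split; exact: leey.
suff [S xS [h1 h2 h3]] : exists2 S : {fset str}, x \in S &
    [/\ Lambda U S <= l + (deficiency U x A - b) + e,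
        (Kset U S)%:R <= (Kset U A)%:R + (l - Lambda U A) + (deficiency U x A - b) + e &
        (Kset U S)%:R <= alpha%:R + (h - logcard A) + (deficiency U x A - b) + e].
  by exists S; split=> //=; split; rewrite -?lee_fin in h1 h2 h3 *.
have A0 := card_gt0 xA; have K0 S : (0 < Kset U S)%N := Kcond_gt0 hU _ _.
have lA0 : 0 <= logcard A :> R := logcard_ge0 xA.
have [/andP[/eqP cA /eqP kA]|big] := boolP ((#|` A|%fset == 1) && (Kset U A == 1))%N.
  (* Here [e = 0], and [A] itself is a model once [alpha > 0]. *)
  have lA : logcard A = 0 :> R by rewrite /logcard cA -[RHS](log2_exp 0).
  have e0 : e = 0.
    by rewrite /e /Lambda lA kA addr0 -[1%:R](_ : (2 ^ 0)%:R = _) // log2_exp mulr0.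
  have hl1 : 1 <= l.
    apply: hl => S [xS _]; have := logcard_ge0 (R := R) xS; have := K0 S.
    rewrite -(ler_nat R) /Lambda; lra.
  have hh0 : 0 <= h by apply: hh => S [/logcard_ge0].
  have [a0|a0] := posnP alpha.
    (* No set has complexity 0, so every real number is vacuously a lower bound on the models, hence
       at most [l] and [h]. *)
    have noS S : ~ models U x alpha S.
      by move=> [_]; rewrite a0 leqn0 => /eqP k0; have := K0 S; rewrite k0.
    have l_top a : a <= l by apply: hl => S /noS.
    have h_top a : a <= h by apply: hh => S /noS.
    exists A => //; split.
    - have := l_top (Lambda U A - deficiency U x A + b - e); lra.
    - have := l_top (Lambda U A - deficiency U x A + b - e); lra.
    - have := h_top ((Kset U A)%:R - alpha%:R + logcard A - deficiency U x A + b - e); lra.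
  have hbA : b <= deficiency U x A by apply: hb; split; rewrite ?kA.
  have a1 : 1 <= alpha%:R :> R by rewrite ler1n.
  by exists A => //; rewrite e0 /Lambda lA kA; split; lra.
(* Outside the exceptional case the logarithm is at least 1 and absorbs additive constants. *)
have L2 : 2 <= Lambda U A :> R.
  rewrite /Lambda; have k1 : 1 <= (Kset U A)%:R :> R by rewrite ler1n K0.
  case: (ltnP 1 #|` A|%fset) => cA.
    have : 1 <= logcard A :> R; last lra.
    rewrite -[X in X <= _](log2_exp 1); apply: log2_le; first by rewrite ltr0n.
    by rewrite ler_nat.
  have : 2 <= (Kset U A)%:R :> R; last lra.
  rewrite ler_nat ltn_neqAle K0 andbT eq_sym; move: big.
  by rewrite [#|` A|%fset == 1]eqn_leq cA A0.
(* The successor gives the strict bound by [2 ^ t]. Rounding gives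
   [T <= Lambda(A) + 2 <= 2 Lambda(A)]. *)
pose T := (Kset U A + up_log 2 #|` A|%fset).+1.
pose t := up_log 2 T.
have [|chain [S xS [hS cS]]] := hc t x A xA; first exact: up_logP.
have ht : t.+1%:R <= log2 (Lambda U A) + 3 :> R.
  have h1 : t%:R <= 1 + log2 T%:R :> R by exact: up_log_log2.
  have h2 : log2 T%:R <= log2 (2 * Lambda U A) :> R.
    apply: log2_le; first by rewrite ltr0n.
    have := up_log_log2 (R := R) A0; rewrite -/(logcard A) /T -natr1 natrD.
    by move: L2; rewrite /Lambda; lra.
  move: h2; rewrite log2M2; last lra.
  by rewrite -natr1; lra.
have L1 : 1 <= log2 (Lambda U A) :> R.
  by rewrite -[X in X <= _](log2_exp 1); apply: log2_le; rewrite ?ltr0n.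
have he : 2 * (c * t.+1)%:R + 1 <= e.
  have c0 : 0 <= c%:R :> R by rewrite ler0n.
  have h1 := ler_wpM2l c0 ht; have h2 := ler_wpM2l c0 L1.
  by rewrite /e natrM; lra.
set E := (c * t.+1)%:R in he.
have E0 : 0 <= E :> R by rewrite ler0n.
set k := (Kcond U x [::])%:R : R.
have chainR y : k <= (Kcond U y [::])%:R + (Kcond U x y)%:R + E.
  by rewrite -!natrD ler_nat; exact: chain.
(* For each model, [Lambda - deficiency] equals [K(S') + K(x|S')], which the chain rule bounds below
   by [k - E]. *)
have hkl : k - E + b <= l.
  apply: hl => S' mS'; have := hb _ mS'; have := chainR (encode_list (listing S')).
  rewrite /deficiency /Lambda /Kset /Kgiven; lra.
(* The same argument, with [K(S')] replaced by its bound [alpha]. *)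
have hkh : k - E + b - alpha%:R <= h.
  apply: hh => S' mS'; have := hb _ mS'; have := chainR (encode_list (listing S')).
  have : (Kset U S')%:R <= alpha%:R :> R by rewrite ler_nat; case: mS'.
  rewrite /deficiency /Kset /Kgiven; lra.
have hSR : (Kset U S)%:R + (Kgiven U x A)%:R <= k + E.
  by rewrite -!natrD ler_nat.
have hcS : logcard S <= logcard A + 1 :> R.
  apply: le_trans (_ : (up_log 2 #|` A|%fset)%:R <= _); last by rewrite addrC up_log_log2.
  rewrite -log2_exp; apply: log2_le; first by rewrite ltr0n (card_gt0 xS).
  by rewrite ler_nat.
(* One [E] is lost in the chain rule and one in [K(S)]; the remaining 1 comes from rounding [|A|] up
   to a power of two. *)
exists S => //; rewrite /Lambda /deficiency; split; lra.
Qed.
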